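(* Suppose that $E(Y^2)<\infty$, $E(\|X\|^2)<\infty$, $V(Y)>0$, $V(X)$ is non-singular, and $E(Y|X)=\alpha_0+X'\beta_0$ for some $(\alpha_0,\beta_0)\in\mathbb{R}\times\mathbb{R}^p$. Then the identified set $\mathcal{B}$ of $\beta_0$ satisfies $$\mathcal{B}=\left\{\lambda q:\; q\in\mathcal{S},\; 0\le\lambda\le S(F_{Y_0},F_{X_0'q})\right\}.$$ Moreover, $\mathcal{B}$ includes $0_p$ and is a convex, compact subset of $\mathcal{B}^V=\{\beta\in\mathbb{R}^p:\ \beta'V(X)\beta\le V(Y)\}$.
   Context: $Y$ is a real random variable and $X$ a random vector in $\mathbb{R}^p$. $V(\cdot)$ denotes the variance (matrix), $\|\cdot\|$ the Euclidean norm, $\mathcal{S}$ the unit sphere of $\mathbb{R}^p$, $0_p$ the zero vector, $F_A$ the cdf of a random variable $A$, and $\overset{d}{=}$ equality in distribution. For any integrable random variable or vector $A$, $A_0:=A-E(A)$. For a cdf $F$ on $\mathbb{R}$, $F^{-1}(t)=\inf\{x:F(x)\ge t\}$. For cdfs $F,G$ on $\mathbb{R}$ with expectation $0$ and $\alpha\in(0,1)$, $$R(\alpha,F,G)=\frac{\int_\alpha^1F^{-1}(t)dt}{\int_\alpha^1G^{-1}(t)dt},\qquad S(F,G)=\inf_{\alpha\in(0,1)}R(\alpha,F,G).$$ Only the marginal distributions of $Y$ and of $X$ are known, and the identified set of $\beta_0$ is $$\mathcal{B}=\left\{\beta\in\mathbb{R}^p:\ \exists\text{ random variables }(\widetilde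 X,\widetilde Y):\ E(\widetilde Y_0|\widetilde X_0)=\widetilde X_0'\beta,\ \widetilde X\overset{d}{=}X,\ \widetilde Y\overset{d}{=}Y\right\}.$$ *)

(* Defs.v *)
From HB Require Import structures.
From mathcomp Require Import all_boot all_order all_algebra.
From mathcomp Require Import all_classical all_reals all_analysis.
From mathcomp Require Import measurable_realfun.

Set Implicit Arguments.
Unset Strict Implicit.
Unset Printing Implicit Defensive.

Import Order.TTheory GRing.Theory Num.Theory.
Import numFieldNormedType.Exports.

Local Open Scope classical_set_scope.
Local Open Scope ring_scope.

Section euclidean.
Context {R : realType} {p : nat}.

(* Random vectors take values in p.-tuple R, which carries the product Borel
   sigma-algebra; the deterministic vectors beta and q live in 'cV[R]_p, which
   carries the linear and topological structures. [vec] goes from the former to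
   the latter. *)
Definition vec (x : p.-tuple R) : 'cV[R]_p := \col_i tnth x i.

Definition dotp (x : p.-tuple R) (b : 'cV[R]_p) : R :=
  ((vec x)^T *m b) ord0 ord0.

(* The norm of 'cV[R]_p in the library is the sup norm. *)
Definition enorm (v : 'cV[R]_p) : R := Num.sqrt (\sum_i v i ord0 ^+ 2).

Definition unit_sphere : set 'cV[R]_p := [set q | enorm q = 1].

End euclidean.

Section centering.
Context d {T : measurableType d} {R : realType} (P : probability T R).

Definition center (A : T -> R) : T -> R := fun w => A w - fine 'E_P[A].

Definition vcenter (p : nat) (X : T -> p.-tuple R) : T -> p.-tuple R :=
  fun w => [tuple center (fun w' => tnth (X w') i) w | i < p].

Lemma measurable_center (A : T -> R) :
  measurable_fun [set: T] A -> measurable_fun [set: T] (center A).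
Proof. by move=> mA; apply: measurable_funB. Qed.

Lemma measurable_vcenter_dotp (p : nat) (X : T -> p.-tuple R) (q : 'cV[R]_p) :
  measurable_fun [set: T] X ->
  measurable_fun [set: T] (fun w => dotp (vcenter X w) q).
Proof.
move=> /measurable_fun_tnthP mX.
rewrite [X in measurable_fun _ X](_ : _ = fun w =>
  \sum_i center (fun w' => tnth (X w') i) w * q i ord0); last first.
  apply/funext => w; rewrite /dotp mxE; apply: eq_bigr => i _.
  by rewrite !mxE tnth_mktuple.
apply: measurable_sum => i; apply: measurable_funM; last exact: measurable_cst.
exact/measurable_center/mX.
Qed.

Section real.
Variable Y : {RV P >-> R}.

Let centerY : T -> R := center Y.

HB.instance Definition _ := isMeasurableFun.Build _ _ _ _ centerY
  (measurable_center (@measurable_funPT _ _ _ _ Y)).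

Definition centerRV : {RV P >-> R} := centerY.

End real.

Section vector.
Variables (p : nat) (X : {RV P >-> p.-tuple R}) (q : 'cV[R]_p).

Let projX : T -> R := fun w => dotp (vcenter X w) q.

HB.instance Definition _ := isMeasurableFun.Build _ _ _ _ projX
  (measurable_vcenter_dotp q (@measurable_funPT _ _ _ _ X)).

Definition center_dotRV : {RV P >-> R} := projX.

End vector.

Definition covmx (p : nat) (X : T -> p.-tuple R) : 'M[R]_p :=
  \matrix_(i, j) fine (covariance P (fun w => tnth (X w) i)
                                    (fun w => tnth (X w) j)).

(* [is_condE A X Z]: the random variable Z is a version of E(A | X). *)
Definition is_condE d' (T' : measurableType d') (A : T -> R) (X : T -> T')
    (Z : T -> R) : Prop :=
  [/\ P.-integrable [set: T] (EFin \o A),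
      measurable_fun [set: g_sigma_algebra_preimageType X] Z,
      P.-integrable [set: T] (EFin \o Z) &
      forall E, g_sigma_algebra_preimage X E ->
        (\int[P]_(w in E) (Z w)%:E = \int[P]_(w in E) (A w)%:E)%E].

End centering.

Definition eq_dist d1 d2 d' (T1 : measurableType d1) (T2 : measurableType d2)
    (T' : measurableType d') (R : realType)
    (P1 : probability T1 R) (P2 : probability T2 R)
    (A1 : {RV P1 >-> T'}) (A2 : {RV P2 >-> T'}) : Prop :=
  forall B : set T', measurable B ->
    distribution P1 A1 B = distribution P2 A2 B.

(* [inf] is the real infimum, equal to 0 by convention on a set that is empty or
   unbounded below; this default is not met for the cdf of an integrable
   variable at 0 < t < 1, nor for [Sratio] when F and G are cdfs with mean 0 and
   G is nondegenerate. *)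
Section ratio.
Context {R : realType}.
Implicit Types F G : R -> \bar R.

Definition quantile F (t : R) : R := inf [set x | (t%:E <= F x)%E].

Definition Rratio (alpha : R) F G : R :=
  (\int[lebesgue_measure]_(t in `]alpha, 1[) quantile F t) /
  (\int[lebesgue_measure]_(t in `]alpha, 1[) quantile G t).

Definition Sratio F G : R :=
  inf [set Rratio alpha F G | alpha in `]0, 1[%classic].

End ratio.

Section identified_set.
Context d {T : measurableType d} {R : realType} (P : probability T R) (p : nat).
Variables (Y : {RV P >-> R}) (X : {RV P >-> p.-tuple R}).

(* The coupling may live on any probability space. *)
Definition identified_set : set 'cV[R]_p :=
  [set beta | exists (d' : measure_display) (T' : measurableType d')
      (P' : probability T' R)
      (X' : {RV P' >-> p.-tuple R}) (Y' : {RV P' >-> R}),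
    [/\ is_condE P' (center P' Y') (vcenter P' X')
          (fun w => dotp (vcenter P' X' w) beta),
        eq_dist X' X & eq_dist Y' Y]].

Definition variance_bound_set : set 'cV[R]_p :=
  [set beta | (((beta^T *m covmx P X *m beta) ord0 ord0)%:E <= 'V_P[Y])%E].

End identified_set.

(* Main.v *)
(* By definition, [b] is in the identified set iff there is a martingale coupling
   of [Z = X0'b] and [Y0] which extends to [X]. The following are equivalent:
   (i) such a coupling exists; (ii) [E (Z - c)^+ <= E (Y0 - c)^+] for all [c];
   (iii) the integrals over [(a, 1)] of the quantile functions [x] of [Z] and [y]
   of [Y0] are ordered for all [a]. (i) => (ii) integrates over [Z > c], and
   (ii) => (iii) takes [c = y a].

   (iii) => (i) is the explicit coupling of Jourdain and Margheriti. The measures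
   with densities [(x - y)^+] and [(x - y)^-] have the same mass, and by (iii)
   the monotone transport [a] of the first to the second moves mass to the
   right. If [x u > y u], then [y u < x u <= x (a u) < y (a u)], and [x u] is
   split between [y u] and [y (a u)]; if [x u < y u], it is split between [y u]
   and the value of [y] at the transport of [u] in the other direction. The two
   mass displacements compensate, so that the result has the law of [y U] if [U]
   is uniform. On [T * R * R], a uniform [U] with [x U = Z] is built from [Z] by
   the distributional transform, which needs one auxiliary uniform variable; the
   other one performs the split.

   (ii) gives convexity and closedness, (iii) gives the ratio [S] because the
   integrals are positively homogeneous in [b], and the explicit coupling gives
   the variance bound by Jensen's inequality, whence boundedness. *)

Require Import Defs.
From HB Require Import structures.
From mathcomp Require Import all_boot all_order all_algebra.
From mathcomp Require Import all_classical all_reals all_analysis.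
From mathcomp Require Import measurable_realfun ring lra.

Set Implicit Arguments.
Unset Strict Implicit.
Unset Printing Implicit Defensive.

Import Order.TTheory GRing.Theory Num.Theory.
Import numFieldNormedType.Exports.

Local Open Scope classical_set_scope.
Local Open Scope ring_scope.

(** * The uniform law and quantile functions *)

(** The two measures to be matched have densities for the uniform law, hence no atoms: the monotone
    transport is then explicit, a quantile function after a cdf, and its graph is the law of the
    pair of quantile functions at a common uniform level. The transports in the two directions
    therefore have the same graph, up to null sets. This is what makes the displacements compensate:
    the weight [1 / (y v - y u)] of a pair [u], [v] is the same for the jump from [u] to [v] as for
    the jump back.

    With equal means, the order of the upper tails says that the integral of [(x - y)^-] over any
    lower interval is at most that of [(x - y)^+]. This orders the cdfs of the two normalised
    measures, and so their quantile functions.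

    The conditional expectation has to be taken given [X], not only given [Z = X0'b]. On [T * R * R]
    the integral over the last coordinate is [x U = Z] almost surely, whatever the point of [T], so
    the martingale identity holds on every event of [T], in particular on those of [X]. *)

Lemma eq_measure_ae d (T : measurableType d) (R : realType)
    (m : {measure set T -> \bar R}) (A B : set T) :
  measurable A -> measurable B -> {ae m, forall x, A x <-> B x} -> m A = m B.
Proof.
move=> mA mB AB.
rewrite -[LHS]mul1e -[RHS]mul1e -(integral_cst _ mA) -(integral_cst _ mB).
rewrite integral_mkcond [RHS]integral_mkcond.
apply: ge0_ae_eq_integral => //.
- exact: ((measurable_restrictT (cst 1%E) mA).1 (measurable_cst _)).
- exact: ((measurable_restrictT (cst 1%E) mB).1 (measurable_cst _)).
- by move=> x _; rewrite patchE; case: ifPn.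
- by move=> x _; rewrite patchE; case: ifPn.
apply: filterS AB => u ABu _; rewrite !patchE.
by rewrite (_ : (u \in A) = (u \in B))//; apply/idP/idP; rewrite !inE => /ABu.
Qed.

Lemma measure_unique_itvNyo (R : realType)
    (m1 m2 : probability R R) :
  (forall a, m1 `]-oo, a[%classic = m2 `]-oo, a[%classic) ->
  forall A, measurable A -> m1 A = m2 A.
Proof.
move=> m12 A mA.
apply: (@measure_unique _ _ R (@RGenInftyO.G R)
    (fun n => `]-oo, n%:R[%classic)) => //.
- exact: RGenInftyO.measurableE.
- move=> _ _ [a ->] [b ->]; exists (Num.min a b).
  apply/seteqP; split => x /=; rewrite !in_itv/= lt_min.
    by case=> -> ->.
  by move=> /andP.
- by move=> n; exists n%:R.
- rewrite -subTset => x _; exists (Num.truncn x).+1 => //=.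
  by rewrite in_itv/= truncnS_gt.
- by move=> _ [a ->]; exact: m12.
- by move=> n; rewrite (le_lt_trans (probability_le1 _ _)) ?ltry.
Qed.

(** Complements of closed half-lines form a generating class stable under intersection. Closed
    half-lines suit quantile functions, open ones the distributional transform. *)
Lemma measure_unique_itvNyc (R : realType)
    (m1 m2 : probability R R) :
  (forall a, m1 `]-oo, a]%classic = m2 `]-oo, a]%classic) ->
  forall A, measurable A -> m1 A = m2 A.
Proof.
move=> m12 A mA.
apply: (@measure_unique _ _ R (@RGenOInfty.G R)
    (fun n => `](- n%:R), +oo[%classic)) => //.
- exact: RGenOInfty.measurableE.
- move=> _ _ [a ->] [b ->]; exists (Num.max a b).
  apply/seteqP; split => x /=; rewrite !in_itv/= !andbT gt_max.
    by case=> -> ->.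
  by move=> /andP.
- by move=> n; exists (- n%:R).
- rewrite -subTset => x _; exists (Num.truncn (- x)).+1 => //=.
  by rewrite in_itv/= andbT ltrNl truncnS_gt.
- move=> _ [a ->]; rewrite -setCitvl.
  by rewrite [LHS](probability_setC m1)// [RHS](probability_setC m2)// m12.
- by move=> n; rewrite (le_lt_trans (probability_le1 _ _)) ?ltry.
Qed.

Section uniform01.
Context {R : realType}.
Local Open Scope ereal_scope.

Let idTR : measurableTypeR R -> R := idfun.

#[local] HB.instance Definition _ :=
  @isMeasurableFun.Build _ _ _ _ idTR (@measurable_id _ _ setT).

(* [uniform_prob] lives on [measurableTypeR R], whose display is not the default
   one of [R]. *)
Definition unif01 : probability R R :=
  distribution (uniform_prob (@ltr01 R)) idTR.

Lemma ge0_integral_unif01 (D : set R) (f : R -> \bar R) : measurable D ->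
  D `<=` `[0%R, 1%R]%classic -> measurable_fun D f ->
  (forall x, D x -> 0 <= f x) ->
  \int[unif01]_(x in D) f x = \int[lebesgue_measure]_(x in D) f x.
Proof.
move=> mD D01 mf f0.
rewrite ge0_integral_pushforward//; last by move=> x; rewrite inE; exact: f0.
rewrite integral_mkcond integral_uniform.
- rewrite subr0 invr1 mul1e -integral_mkcondr setIC setIidl//.
- have mf' : measurable_fun (D : set (measurableTypeR R)) f := mf.
  by have := (@measurable_restrictT _ _ (measurableTypeR R) _ D f mD).1 mf'.
- by move=> x; rewrite patchE; case: ifPn => // /[!inE]; exact: f0.
Qed.


Lemma unif01E (A : set R) : measurable A -> A `<=` `[0%R, 1%R]%classic ->
  unif01 A = lebesgue_measure A.
Proof.
move=> mA A01; rewrite -[LHS]mul1e -(integral_cst _ mA 1).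
rewrite ge0_integral_unif01//.
by rewrite integral_cst// mul1e.
Qed.

Lemma integral_unif01 (D : set R) (f : R -> \bar R) : measurable D ->
  D `<=` `[0%R, 1%R]%classic -> measurable_fun D f ->
  \int[unif01]_(x in D) f x = \int[lebesgue_measure]_(x in D) f x.
Proof.
move=> mD D01 mf; rewrite integralE [RHS]integralE.
rewrite !ge0_integral_unif01//; first exact: measurable_funeneg.
exact: measurable_funepos.
Qed.

Lemma unif01_oo : unif01 `]0%R, 1%R[%classic = 1.
Proof.
rewrite unif01E//; last exact: subset_itv_oo_cc.
by rewrite lebesgue_measure_itv/= lte_fin ltr01 sube0.
Qed.

Lemma ae_unif01 : {ae unif01, forall u : R, (0 < u < 1)%R}.
Proof.
exists (~` `]0%R, 1%R[%classic); split => //; first exact: measurableC.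
  by rewrite probability_setC// unif01_oo subee.
Qed.

(** Quantile functions are controlled only inside the open unit interval; this allows half-lines to
    be used in place of their traces on it. *)
Lemma eq_unif01 (A B : set R) : measurable A -> measurable B ->
  (forall u : R, (0 < u < 1)%R -> A u <-> B u) -> unif01 A = unif01 B.
Proof.
by move=> mA mB AB; apply: eq_measure_ae => //; exact: filterS ae_unif01.
Qed.

Lemma eq_integral_unif01 (D1 D2 : set R) (f : R -> \bar R) :
  measurable D1 -> measurable D2 -> measurable_fun [set: R] f ->
  (forall u, (0 < u < 1)%R -> D1 u <-> D2 u) ->
  \int[unif01]_(u in D1) f u = \int[unif01]_(u in D2) f u.
Proof.
move=> mD1 mD2 mf D12; rewrite integral_mkcond [RHS]integral_mkcond.
apply: ae_eq_integral => //.
- exact: ((measurable_restrictT f mD1).1 (measurable_funTS mf)).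
- exact: ((measurable_restrictT f mD2).1 (measurable_funTS mf)).
apply: filterS ae_unif01 => u /D12 D12u _; rewrite !patchE.
by rewrite (_ : (u \in D1) = (u \in D2))//; apply/idP/idP; rewrite !inE => /D12u.
Qed.

Lemma unif01_itvNyo (a : R) : (0 <= a <= 1)%R -> unif01 `]-oo, a[%classic = a%:E.
Proof.
move=> /andP[a0 a1].
rewrite (@eq_unif01 _ `]0%R, a[%classic)//.
  rewrite unif01E//.
    rewrite lebesgue_measure_itv/= lte_fin; case: ltrP => [_|a0'].
      by rewrite sube0.
    by rewrite (@le_anti _ _ a 0%R) ?a0 ?a0'.
  move=> x/=; rewrite !in_itv/= => /andP[x0 xa].
  by rewrite (ltW x0) (le_trans (ltW xa)).
by move=> u /andP[u0 u1]/=; rewrite !in_itv/= u0.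
Qed.

Lemma unif01_itvNyc (a : R) : (0 <= a <= 1)%R -> unif01 `]-oo, a]%classic = a%:E.
Proof.
move=> /andP[a0 a1].
rewrite (@eq_unif01 _ `]0%R, a]%classic)//.
  rewrite unif01E//.
    rewrite lebesgue_measure_itv/= lte_fin; case: ltrP => [_|a0'].
      by rewrite sube0.
    by rewrite (@le_anti _ _ a 0%R) ?a0 ?a0'.
  move=> x/=; rewrite !in_itv/= => /andP[x0 xa].
  by rewrite (ltW x0) (le_trans xa).
by move=> u /andP[u0 u1]/=; rewrite !in_itv/= u0.
Qed.

End uniform01.

Section quantile_function.
Context {R : realType} (nu : probability R R).
Local Open Scope ereal_scope.

(* Set to [0] outside of the unit interval, where [quantile] is a junk value. *)
Definition qtl (t : R) : R :=
  if (0 < t < 1)%R then quantile (fun r => nu `]-oo, r]%classic) t else 0%R.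

Let F (r : R) := nu `]-oo, r]%classic.

Let F_nd r s : (r <= s)%R -> F r <= F s.
Proof. by move=> rs; rewrite le_measure ?inE//; exact: subset_itvl. Qed.

Let FK r : ((fine (F r))%:E = F r). Proof. by rewrite fineK// fin_num_measure. Qed.

Let idR : R -> R := idfun.

#[local] HB.instance Definition _ :=
  @isMeasurableFun.Build _ _ _ _ idR (@measurable_id _ _ setT).

Let FE : F = cdf (idR : {RV nu >-> R}).
Proof. by []. Qed.

(** The limits of the cdf at both infinities make the set under the infimum nonempty and bounded
    below, and right continuity makes the infimum a member of it. This Galois connection is how
    quantiles are handled from here on. *)
Lemma qtl_le (t x : R) : (0 < t < 1)%R -> (qtl t <= x)%R <-> t%:E <= F x.
Proof.
move=> t01; rewrite /qtl t01 /quantile -/F; move: t01 => /andP[t0 t1].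
set E := [set x | _].
have E0 : E !=set0.
  have : nbhs 1 [set y : \bar R | t%:E < y].
    by apply: open_nbhs_nbhs; split; [exact: open_ereal_gt_ereal|rewrite /= lte_fin].
  move=> /(cvg_cdfy1 (idR : {RV nu >-> R})) H.
  have [z /ltW zt] := @filter_ex _ (pinfty_nbhs R) _ (fun z => t%:E < F z) H.
  by exists z.
have Elb : has_lbound E.
  have : nbhs 0 [set y : \bar R | y < t%:E].
    by apply: open_nbhs_nbhs; split; [exact: open_ereal_lt_ereal|rewrite /= lte_fin].
  move=> /(cvg_cdfNy0 (idR : {RV nu >-> R})) H.
  have [z zt] := @filter_ex _ (ninfty_nbhs R) _ (fun z => F z < t%:E) H.
  exists z => y tFy.
  rewrite leNgt; apply/negP => /ltW/F_nd yz.
  by have := le_lt_trans (le_trans tFy yz) zt; rewrite ltxx.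
split => [|tF]; last exact: ge_inf.
move=> Ex; apply: (@le_trans _ _ (F (inf E))); last exact: F_nd.
rewrite leNgt; apply/negP => Flt.
have : nbhs (F (inf E)) [set y : \bar R | y < t%:E].
  by apply: open_nbhs_nbhs; split; [exact: open_ereal_lt_ereal|].
move=> H; have [e /= e0 eP] := @cdf_right_continuous _ _ _ _ (idR : {RV nu >-> R}) _ _ H.
have [y Ey yE] := inf_adherent e0 (conj E0 Elb).
have infy : (inf E <= y)%R by exact: ge_inf.
have {}infy : (inf E < y)%R.
  rewrite lt_neqAle infy andbT; apply/eqP => infy'.
  by move: Flt; rewrite infy' ltNge => /negP; exact.
have yF : F y < t%:E.
  apply: eP => //=.
  by rewrite distrC gtr0_norm ?subr_gt0// ltrBlDl.
by have := lt_le_trans yF Ey; rewrite ltxx.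
Qed.

Lemma qtl_nd (s t : R) : (0 < s)%R -> (s <= t)%R -> (t < 1)%R ->
  (qtl s <= qtl t)%R.
Proof.
move=> s0 st t1; apply/qtl_le; first by rewrite s0 (le_lt_trans st).
apply: (@le_trans _ _ t%:E) => //.
by apply/qtl_le => //; rewrite (lt_le_trans s0).
Qed.

(** By [qtl_le], the preimage of an open upper half-line is, within the unit interval, again one. *)
Lemma measurable_qtl : measurable_fun [set: R] qtl.
Proof.
apply: measurable_fun_if => //=.
  by apply: measurable_and => //; exact: measurable_fun_ltr.
rewrite setTI; set D := _ @^-1` _.
have DE : D = `]0%R, 1%R[%classic.
  by apply/seteqP; split => t/=; rewrite in_itv.
apply: (measurability (@RGenOInfty.G R)) => [|/= _ [_] [r ->] <-].
  exact: RGenOInfty.measurableE.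
rewrite (_ : _ `&` _ = `]0%R, 1%R[ `&` `]fine (F r), +oo[%classic).
  exact: measurableI.
rewrite DE; apply/seteqP; split => t/= [t01]; rewrite !in_itv/= !andbT;
  (split; first exact: t01); move: t01; rewrite in_itv/= => t01;
  have := qtl_le r t01; rewrite /qtl t01 -FK lee_fin => qF.
  by rewrite ltNge; apply/negP => /qF; rewrite leNgt => /negP.
by rewrite ltNge; apply/negP => /qF; rewrite leNgt => /negP.
Qed.

Lemma qtl_law A : measurable A -> unif01 (qtl @^-1` A) = nu A.
Proof.
pose qtl' : {mfun R >-> R} := HB.pack qtl (isMeasurableFun.Build _ _ _ _ qtl measurable_qtl).
apply: (@measure_unique_itvNyc _ (distribution unif01 qtl') nu) => a.
have Fa : (0 <= fine (F a) <= 1)%R.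
  by rewrite fine_ge0//= -lee_fin FK probability_le1.
transitivity (unif01 `]-oo, fine (F a)]%classic).
  apply: eq_unif01 => //; first exact: measurable_funPTI.
  move=> u u01/=; rewrite !in_itv/= -[(u <= _)%R]lee_fin FK; exact: qtl_le.
by rewrite unif01_itvNyc.
Qed.

End quantile_function.

(** * Change of variables along a map of known law *)

Section law_transfer.
Context d d' {T : measurableType d} {T' : measurableType d'} {R : realType}.
Variables (m : {measure set T -> \bar R}) (n : {measure set T' -> \bar R}).
Variable f : T -> T'.
Hypothesis mf : measurable_fun [set: T] f.
Hypothesis mn : forall A, measurable A -> m (f @^-1` A) = n A.
Local Open Scope ereal_scope.

(** The image law enters as a hypothesis [mn] rather than as a pushforward, because the maps in play
    (quantile functions, distributional transforms, projections) have image laws already identified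
    with a simpler measure. *)
Lemma ge0_integral_law (h : T' -> \bar R) : measurable_fun [set: T'] h ->
  (forall y, 0 <= h y) -> \int[m]_x h (f x) = \int[n]_y h y.
Proof.
move=> mh h0.
have := @ge0_integral_pushforward _ _ _ _ _ f mf m setT h measurableT mh
  (fun y _ => h0 y).
rewrite preimage_setT => <-.
by apply: eq_measure_integral => A mA _; rewrite -mn.
Qed.

Lemma integral_law (h : T' -> \bar R) : measurable_fun [set: T'] h ->
  \int[m]_x h (f x) = \int[n]_y h y.
Proof.
move=> mh; rewrite integralE [RHS]integralE.
 rewrite -/(h \o f) funepos_comp funeneg_comp.
by congr (_ - _); apply: ge0_integral_law => //;
  [exact: measurable_funepos|exact: measurable_funeneg].
Qed.

Lemma integrable_law (h : T' -> \bar R) : n.-integrable [set: T'] h ->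
  m.-integrable [set: T] (h \o f).
Proof.
move=> /integrableP[mh hoo]; apply/integrableP; split.
  exact: measurableT_comp.
by rewrite (@ge0_integral_law (fun y => `|h y|))//; exact: measurableT_comp.
Qed.

End law_transfer.

Lemma integral_cst_probability d (T : measurableType d) (R : realType)
    (P : probability T R) (r : R) : (\int[P]_x r%:E = r%:E)%E.
Proof.
rewrite -[RHS]mule1 -(probability_setT P).
exact: (integral_cst _ measurableT r%:E).
Qed.

Lemma integrable_distribution d (T : measurableType d) (R : realType)
    (P : probability T R) (Z : {RV P >-> R}) :
  P.-integrable [set: T] (EFin \o Z) ->
  (distribution P Z).-integrable [set: R] EFin.
Proof.
move=> iZ; have iZ' : P.-integrable (Z @^-1` setT) (EFin \o Z).
  by rewrite preimage_setT.
exact: (integrable_pushforward (measurable_funPT Z) _ iZ').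
Qed.

Section product_ae.
Context d1 d2 {T1 : measurableType d1} {T2 : measurableType d2} {R : realType}.
Variables (P1 : probability T1 R) (P2 : probability T2 R).
Local Open Scope ereal_scope.

Lemma product_probabilityE (A : set T1) (B : set T2) :
  measurable A -> measurable B -> (P1 \x P2) (A `*` B) = P1 A * P2 B.
Proof. exact: product_measure1E. Qed.

Lemma ae_prod_snd (Q : T2 -> Prop) : {ae P2, forall x, Q x} ->
  {ae (P1 \x P2), forall z, Q z.2}.
Proof.
move=> [N [mN N0 QN]]; exists (setT `*` N); split.
- exact: measurableX.
- by rewrite product_probabilityE// N0 mule0.
- by move=> z /= nQ; split => //; exact: QN.
Qed.

Lemma product_measure_fst (A : set T1) : measurable A ->
  (P1 \x P2) (fst @^-1` A) = P1 A.
Proof.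
move=> mA; rewrite (_ : _ @^-1` _ = A `*` setT).
  by rewrite product_probabilityE// -[RHS]mule1 -(probability_setT P2).
by apply/seteqP; split => z//= [].
Qed.

End product_ae.

(** * The distributional transform *)

Section distributional_transform.
Context d {T : measurableType d} {R : realType} (P : probability T R).
Variable Z : {RV P >-> R}.
Local Open Scope ereal_scope.

Let nu : probability R R := distribution P Z.
Let G (z : R) : R := fine (nu `]-oo, z[%classic).
Let F (z : R) : R := fine (nu `]-oo, z]%classic).
Let J (z : R) : R := fine (nu [set z]).

(* With an independent uniform variable in second position, this spreads the
   mass of an atom [z] of [Z] uniformly over the jump of the cdf at [z]. *)
Definition dist_transform (tv : T * R) : R :=
  (fine (distribution P Z `]-oo, Z tv.1[%classic) +
   tv.2 * fine (distribution P Z [set Z tv.1]))%R.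

Let GE z : (G z)%:E = nu `]-oo, z[%classic.
Proof. by rewrite fineK// fin_num_measure. Qed.

Let FE z : (F z)%:E = nu `]-oo, z]%classic.
Proof. by rewrite fineK// fin_num_measure. Qed.

Let JE z : (J z)%:E = nu [set z].
Proof. by rewrite fineK// fin_num_measure. Qed.

Let J0 z : (0 <= J z)%R. Proof. exact: fine_ge0. Qed.

Let GJ z : (G z + J z = F z)%R.
Proof.
apply: EFin_inj; rewrite EFinD GE JE FE.
rewrite (_ : `]-oo, z]%classic = `]-oo, z[%classic `|` [set z]).
  rewrite measureU//; apply/seteqP; split => // x/= [].
  by rewrite in_itv/= => /[swap] ->; rewrite ltxx.
apply/seteqP; split => x/=; rewrite !in_itv/= le_eqVlt.
  by move=> /orP[/eqP->|->]; [right|left].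
by move=> [->|->]; rewrite ?eqxx ?orbT.
Qed.

Let G_nd : {homo G : x y / (x <= y)%R}.
Proof.
by move=> x y xy; rewrite -lee_fin !GE le_measure ?inE//; exact: subset_itvl.
Qed.

Let F_nd : {homo F : x y / (x <= y)%R}.
Proof.
by move=> x y xy; rewrite -lee_fin !FE le_measure ?inE//; exact: subset_itvl.
Qed.

Let FG x y : (x < y)%R -> (F x <= G y)%R.
Proof.
move=> xy; rewrite -lee_fin GE FE le_measure ?inE//.
by apply: subset_itvl; rewrite bnd_simp.
Qed.

Lemma measurable_dist_transform : measurable_fun [set: T * R] dist_transform.
Proof.
have mG : measurable_fun [set: R] G by exact: nondecreasing_measurable.
have mF : measurable_fun [set: R] F by exact: nondecreasing_measurable.
have mJ : measurable_fun [set: R] J.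
  rewrite (_ : J = F \- G)%R; first exact: measurable_funB.
  by apply/funext => z /=; rewrite -GJ addrAC subrr add0r.
have mZ : measurable_fun [set: T * R] (fun tv : T * R => Z tv.1).
  by apply: measurableT_comp => //; exact: measurable_fst.
apply: measurable_funD; first exact: (measurableT_comp mG).
by apply: measurable_funM => //; exact: (measurableT_comp mJ).
Qed.

Let U := dist_transform.

Let mU A : measurable A -> measurable (U @^-1` A).
Proof.
move=> mA; rewrite -[X in measurable X]setTI.
exact: measurable_dist_transform.
Qed.

(** With [q] the quantile at [a], one has [G q <= a <= F q]. Up to a null set the event consists of
    [Z < q], of mass [G q], and of the part of the atom at [q] where [v] is below [(a - G q) / J q];
    the masses add up to [a]. *)
Let law_lt (a : R) : (0 < a < 1)%R ->
  (P \x unif01) (U @^-1` `]-oo, a[%classic) = a%:E.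
Proof.
move=> a01; set q := qtl nu a.
have aF : (a <= F q)%R by rewrite -lee_fin FE; exact/qtl_le.
have /andP[a0 a1] := a01.
(* [G q] is the uniform mass of the levels whose quantile is below [q]; by monotonicity these levels
   are at most [a]. *)
have Ga : (G q <= a)%R.
  rewrite -lee_fin GE -qtl_law// -(@unif01_itvNyc _ a) ?(ltW a0) ?(ltW a1)//.
  rewrite (@eq_unif01 _ _ (qtl nu @^-1` `]-oo, q[%classic `&`
                           `]0%R, 1%R[%classic)); last 3 first.
  - by rewrite -[X in measurable X]setTI; exact: measurable_qtl.
  - apply: measurableI => //.
    by rewrite -[X in measurable X]setTI; exact: measurable_qtl.
  - by move=> u u01/=; rewrite [u \in _]in_itv/= u01; split => [?|[]].
  apply: le_measure; rewrite ?inE//.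
    apply: measurableI => //.
    by rewrite -[X in measurable X]setTI; exact: measurable_qtl.
  move=> u/= []; rewrite !in_itv/= => qu /andP[u0 u1].
  rewrite leNgt; apply/negP => /ltW au.
  by have := lt_le_trans qu (qtl_nd nu a0 au u1); rewrite ltxx.
have mB2 : measurable [set v : R | (G q + v * J q < a)%R].
  rewrite -[X in measurable X]setTI.
  by apply: measurable_fun_ltr => //; apply: measurable_funD => //; exact: measurable_funM.
pose B := (Z @^-1` `]-oo, q[%classic `*` [set: R]) `|`
          (Z @^-1` [set q] `*` [set v : R | (G q + v * J q < a)%R]).
rewrite (@eq_measure_ae _ _ _ _ _ B); last 3 first.
- exact: mU.
- by apply: measurableU; apply: measurableX => //; exact: measurable_funPTI.
- apply: filterS (ae_prod_snd P ae_unif01) => -[t v]/= /andP[v0 v1].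
  rewrite /U /dist_transform /B /= -/(G _) -/(J _) !in_itv/=.
  case: (ltgtP (Z t) q) => Zq.
  + split => [_|_]; first by left.
    have : ~ (a <= F (Z t))%R.
      by rewrite -lee_fin FE => /(qtl_le nu _ a01); rewrite leNgt Zq.
    move/negP; rewrite -ltNge; apply: le_lt_trans.
    by rewrite -GJ lerD2l ler_piMl// ltW.
  + split => [|[[]//|[] Zq']]; last by rewrite Zq' ltxx in Zq.
    rewrite ltNge (le_trans (le_trans aF (FG Zq)))//.
    by rewrite lerDl mulr_ge0// ltW.
  + by rewrite Zq; split => [|[[]//|[]//]]; right.
have mq1 : measurable (Z @^-1` `]-oo, q[%classic) by exact: measurable_funPTI.
have mq2 : measurable (Z @^-1` [set q]) by exact: measurable_funPTI.
rewrite measureU//; last 3 first.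
- by apply: measurableX => //; exact: measurable_funPTI.
- by apply: measurableX => //; exact: measurable_funPTI.
- apply/seteqP; split => // -[t v] /= [[]]; rewrite in_itv/= => + _ [Zq].
  by rewrite Zq ltxx.
transitivity ((G q)%:E * unif01 [set: R] +
              (J q)%:E * unif01 [set v : R | (G q + v * J q < a)%R]).
  by rewrite GE JE; congr (_ + _); exact: product_probabilityE.
rewrite probability_setT mule1.
(* Without an atom at [q] the bounds on [a] collapse to [G q = a], and the second term vanishes. *)
have [Jq0|Jq0] := eqVneq (J q) 0%R.
  rewrite Jq0 mul0e adde0; congr EFin; apply/le_anti; rewrite Ga.
  by move: aF; rewrite -GJ Jq0 addr0.
have {}Jq0 : (0 < J q)%R by rewrite lt_neqAle eq_sym Jq0 J0.
rewrite (_ : [set v | _] = `]-oo, ((a - G q) / J q)%R[%classic).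
  rewrite unif01_itvNyo; first by rewrite -EFinM -EFinD mulrC divfK ?gt_eqF// addrC subrK.
  by rewrite divr_ge0 ?subr_ge0//= ler_pdivrMr// mul1r lerBlDl GJ.
by apply/seteqP; split => v/=; rewrite in_itv/= ltr_pdivlMr// ltrBrDl.
Qed.

Let lt1_pos (e : R) : (0 < e)%R -> exists e', [/\ (0 < e')%R, (e' < 1)%R & (e' <= e)%R].
Proof.
move=> e0; exists (Num.min e (2^-1)%R); split.
- by rewrite lt_min e0 invr_gt0 ltr0n.
- by rewrite gt_min invf_lt1// ltr1n orbT.
- by rewrite ge_min lexx.
Qed.

Let U' : {mfun (T * R)%type >-> R} :=
  HB.pack U (isMeasurableFun.Build _ _ _ _ U measurable_dist_transform).

Lemma dist_transform_law (A : set R) : measurable A ->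
  (P \x unif01) (dist_transform @^-1` A) = unif01 A.
Proof.
pose m : probability R R := distribution (P \x unif01) U'.
apply: (@measure_unique_itvNyo _ m unif01) => a.
have m_nd b c : (b <= c)%R -> m `]-oo, b[%classic <= m `]-oo, c[%classic.
  by move=> bc; rewrite le_measure ?inE//; exact: subset_itvl.
(* Outside the unit interval the mass is squeezed through [law_lt] at levels close to 0,
   respectively to 1. *)
have [a0|a0] := leP a 0%R.
  rewrite (@eq_unif01 _ _ set0)//; last first.
    by move=> u /andP[u0 _]; split => //=; rewrite in_itv/= ltNge (le_trans a0)// ltW.
  rewrite measure0; apply/le_anti; rewrite measure_ge0 andbT.
  apply/lee_addgt0Pr => e e0; rewrite add0e.
  have [e' [e'0 e'1 e'e]] := lt1_pos e0.
  have e'01 : (0 < e' < 1)%R by rewrite e'0.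
  apply: (@le_trans _ _ e'%:E); last by [].
  rewrite -(law_lt e'01).
  by apply: m_nd; rewrite (le_trans a0)// ltW.
have [a1|a1] := ltP a 1%R.
  by rewrite unif01_itvNyo ?(ltW a0) ?(ltW a1)//; apply: law_lt; rewrite a0.
rewrite (@eq_unif01 _ _ setT)//; last first.
  by move=> u /andP[_ u1]; split => //= _; rewrite in_itv/= (lt_le_trans u1).
rewrite probability_setT; apply/le_anti; rewrite probability_le1//=.
apply/lee_subgt0Pr => e e0.
have [e' [e'0 e'1 e'e]] := lt1_pos e0.
have e'01 : (0 < 1 - e' < 1)%R by rewrite subr_gt0 e'1/= gtrBl.
apply: (@le_trans _ _ (1 - e')%:E); first by rewrite lee_fin lerD2l lerN2.
rewrite -(law_lt e'01).
by apply: m_nd; rewrite (le_trans _ a1)// gerBl ltW.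
Qed.

(** The transform is at most [F (Z t)], so its quantile is at most [Z t]. Both variables have the
    law of [Z], hence the same finite mean, and a nonnegative difference of zero mean vanishes
    almost everywhere. *)
Lemma qtl_dist_transform : P.-integrable [set: T] (EFin \o Z) ->
  {ae P \x unif01, forall tv, qtl nu (dist_transform tv) = Z tv.1}.
Proof.
move=> iZ.
have U01 : {ae P \x unif01, forall tv, (0 < U tv < 1)%R}.
  exists (U @^-1` ~` `]0%R, 1%R[%classic); split.
  - by apply: mU; exact: measurableC.
  - rewrite dist_transform_law; last exact: measurableC.
    by rewrite probability_setC// unif01_oo subee.
  - by move=> tv /=; rewrite in_itv.
have qZ : {ae P \x unif01, forall tv, (qtl nu (U tv) <= Z tv.1)%R}.
  apply: filterS2 (ae_prod_snd P ae_unif01) U01 => -[t v]/= /andP[v0 v1] U01.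
  apply/(qtl_le nu _ U01); rewrite -FE lee_fin -GJ /U /dist_transform/=.
  rewrite -/(G _) -/(J _) lerD2l ler_piMl//; exact: ltW.
have iZ1 : (P \x unif01).-integrable [set: T * R] (fun tv => (Z tv.1)%:E).
  have := @integrable_law _ _ _ _ _ (P \x unif01) P fst measurable_fst
    (product_measure_fst P unif01) _ iZ.
  by [].
have iid := integrable_distribution iZ.
have iq : unif01.-integrable [set: R] (EFin \o qtl nu).
  by apply: (@integrable_law _ _ _ _ _ unif01 nu (qtl nu)
    (measurable_qtl nu) (qtl_law nu) EFin).
have iqU : (P \x unif01).-integrable [set: T * R] (fun tv => (qtl nu (U tv))%:E).
  exact: (@integrable_law _ _ _ _ _ (P \x unif01) unif01 U
    measurable_dist_transform dist_transform_law (EFin \o qtl nu)).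
have E0 : \int[P \x unif01]_tv (Z tv.1 - qtl nu (U tv))%:E = 0.
  under eq_integral do rewrite EFinB.
  rewrite integralB//=.
  rewrite (@integral_law _ _ _ _ _ (P \x unif01) P fst measurable_fst
    (product_measure_fst P unif01) (EFin \o Z))//; last exact: measurable_int iZ.
  rewrite (@integral_law _ _ _ _ _ (P \x unif01) unif01 U
    measurable_dist_transform dist_transform_law (EFin \o qtl nu))//;
    last exact: measurable_int iq.
  rewrite (@integral_law _ _ _ _ _ unif01 nu (qtl nu)
    (measurable_qtl nu) (qtl_law nu) EFin)//.
  rewrite (@integral_law _ _ _ _ _ P nu Z _ _ EFin)// subee//.
  exact: integrable_fin_num.
have mD : measurable_fun [set: T * R] (fun tv => (Z tv.1 - qtl nu (U tv))%:E).
  apply/measurable_EFinP/measurable_funB.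
    by apply/measurable_EFinP; exact: measurable_int iZ1.
  by apply/measurable_EFinP; exact: measurable_int iqU.
have : ae_eq (P \x unif01) setT (fun tv => (Z tv.1 - qtl nu (U tv))%:E) (cst 0).
  apply/ae_eq_integral_abs => //.
  rewrite -[RHS]E0; apply: ae_eq_integral => //; first exact: measurableT_comp.
  apply: filterS qZ => tv qZ _.
  by rewrite gee0_abs// lee_fin subr_ge0.
by apply: filterS => tv /(_ I)/eqP; rewrite eqe subr_eq0 => /eqP.
Qed.

End distributional_transform.

(** * Densities and monotone transport *)

Section density.
Context d {T : measurableType d} {R : realType}.
Variables (mu : {measure set T -> \bar R}) (f : T -> R).
Hypothesis mf : measurable_fun [set: T] f.
Hypothesis f0 : forall x, 0 <= f x.
Hypothesis f1 : (\int[mu]_x (f x)%:E = 1)%E.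
Local Open Scope ereal_scope.

Let dens (A : set T) : \bar R := \int[mu]_(x in A) (f x)%:E.

Let dens0 : dens set0 = 0. Proof. exact: integral_set0. Qed.

Let dens_ge0 A : 0 <= dens A.
Proof. by apply: integral_ge0 => x _; rewrite lee_fin. Qed.

Let dens_sigma_additive : semi_sigma_additive dens.
Proof.
move=> /= F mF tF mUF; rewrite /dens; apply: cvg_toP.
  apply: ereal_nondecreasing_is_cvgn => m n mn.
  apply: lee_sum_nneg_natr => // k _ _.
  by apply: integral_ge0 => /= x Fkx; rewrite lee_fin.
rewrite ge0_integral_bigcup//=.
- by apply/measurable_funTS/measurable_EFinP.
- by move=> x _; rewrite lee_fin.
Qed.

#[local] HB.instance Definition _ := isMeasure.Build _ _ _ dens
  dens0 dens_ge0 dens_sigma_additive.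

#[local] HB.instance Definition _ := @Measure_isProbability.Build _ _ R dens f1.

Definition density : probability T R := dens.

Lemma densityE A : density A = \int[mu]_(x in A) (f x)%:E. Proof. by []. Qed.

Import HBNNSimple.

Let integral_density_indic (A : set T) : measurable A ->
  \int[density]_x (\1_A x)%:E = \int[mu]_x ((f x)%:E * (\1_A x)%:E).
Proof.
move=> mA; transitivity (dens A); first by rewrite integral_indic// setIT.
rewrite /dens integral_mkcond.
apply: eq_integral => x _; rewrite patchE indicE.
by case: ifPn => _; rewrite ?mule1 ?mule0.
Qed.

Let integral_density_nnsfun (g : {nnsfun T >-> R}) :
  \int[density]_x (g x)%:E = \int[mu]_x ((f x)%:E * (g x)%:E).
Proof.
under [LHS]eq_integral do rewrite fimfunE -fsumEFin//.
rewrite [LHS]ge0_integral_fsum//; last 2 first.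
  - by move=> r; exact/measurable_EFinP/measurableT_comp.
  - by move=> n x _; rewrite EFinM nnfun_muleindic_ge0.
under [RHS]eq_integral.
  move=> x xD; rewrite fimfunE -fsumEFin// ge0_mule_fsumr; last first.
    by move=> r; rewrite EFinM nnfun_muleindic_ge0.
  over.
rewrite [RHS]ge0_integral_fsum//; last 2 first.
  - move=> r; apply: emeasurable_funM; first exact/measurable_EFinP.
    by apply/measurable_EFinP; do 2 apply/measurableT_comp => //.
  - move=> n x _; apply: mule_ge0; first by rewrite lee_fin.
    by rewrite EFinM nnfun_muleindic_ge0.
apply: eq_fsbigr => r _.
under [RHS]eq_integral do rewrite EFinM muleCA.
under [LHS]eq_integral do rewrite EFinM.
have [r0|r0] := leP 0%R r.
  rewrite ge0_integralZl//; last exact/measurable_EFinP.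
  rewrite integral_density_indic// ge0_integralZl//.
    by apply: emeasurable_funM => //; exact/measurable_EFinP.
  by move=> x _; rewrite mule_ge0 ?lee_fin.
rewrite preimage_nnfun0// !integral0_eq// => x _; rewrite indic0 ?mule0//.
Qed.

(** Indicators, then simple functions, then monotone limits on both sides. *)
Lemma ge0_integral_density (h : T -> \bar R) :
  measurable_fun [set: T] h -> (forall x, 0 <= h x) ->
  \int[density]_x h x = \int[mu]_x ((f x)%:E * h x).
Proof.
move=> mh h0; pose h_ := nnsfun_approx measurableT mh.
transitivity (lim (\int[density]_x (h_ n x)%:E @[n --> \oo])).
  rewrite -monotone_convergence//=.
  - apply: eq_integral => ? /[!inE] xD; apply/esym/cvg_lim => //=.
    exact: cvg_nnsfun_approx.
  - by move=> n; exact/measurable_EFinP/measurable_funTS.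
  - by move=> n ? _; rewrite lee_fin.
  - by move=> ? _ ? ? mn; rewrite lee_fin; exact/lefP/nd_nnsfun_approx.
transitivity (lim (\int[mu]_x ((f x)%:E * (h_ n x)%:E) @[n --> \oo])).
  by apply: congr_lim; apply/funext => n; exact: integral_density_nnsfun.
rewrite -monotone_convergence//=.
- apply: eq_integral => x /[!inE] xD; apply/cvg_lim => //=.
  by apply: cvgeZl => //; exact: cvg_nnsfun_approx.
- move=> n; apply: emeasurable_funM; first exact/measurable_EFinP.
  exact/measurable_EFinP/measurable_funTS.
- by move=> n ? _; rewrite mule_ge0 ?lee_fin.
- move=> x _ a b ab; rewrite lee_wpmul2l ?lee_fin//.
  exact/lefP/nd_nnsfun_approx.
Qed.

End density.

Section atomless.
Context {R : realType} (m : probability R R).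
Hypothesis m_atomless : forall z, m [set z] = 0%E.
Hypothesis m_integrable : m.-integrable [set: R] EFin.
Local Open Scope ereal_scope.

(** The half-line is open to match [dist_transform], which reduces to this function when there are
    no atoms. *)
Definition strict_cdf (u : R) : R := fine (m `]-oo, u[%classic).

Lemma measurable_strict_cdf : measurable_fun [set: R] strict_cdf.
Proof.
apply: nondecreasing_measurable => // x y xy.
rewrite -lee_fin !fineK ?fin_num_measure// le_measure ?inE//.
exact: subset_itvl.
Qed.

Let idR : R -> R := idfun.

#[local] HB.instance Definition _ :=
  @isMeasurableFun.Build _ _ _ _ idR (@measurable_id _ _ setT).

Let dist_transformE uv :
  dist_transform (idR : {RV m >-> R}) uv = strict_cdf uv.1.
Proof. by rewrite /dist_transform m_atomless mulr0 addr0. Qed.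

(** This is [dist_transform_law] for the identity: all jumps are zero, so the auxiliary uniform
    coordinate has no effect and can be projected out. *)
Lemma strict_cdf_law (A : set R) : measurable A ->
  m (strict_cdf @^-1` A) = unif01 A.
Proof.
move=> mA; rewrite -(dist_transform_law (idR : {RV m >-> R}) mA).
rewrite (_ : _ @^-1` _ = fst @^-1` (strict_cdf @^-1` A)).
  rewrite product_measure_fst//.
  by rewrite -[X in measurable X]setTI; exact: measurable_strict_cdf.
by apply/seteqP; split => uv /=; rewrite dist_transformE.
Qed.

(** Again the distributional transform of the identity. The exceptional set is measurable and does
    not depend on the auxiliary coordinate, so being null for the product makes it null for [m]. *)
Lemma qtl_strict_cdf : {ae m, forall u, qtl m (strict_cdf u) = u}.
Proof.
pose N := [set u | qtl m (strict_cdf u) != u].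
have mN : measurable N.
  rewrite (_ : N = ~` [set u | qtl m (strict_cdf u) == u]); last first.
    by apply/seteqP; split => u /= /negP.
  apply: measurableC; rewrite -[X in measurable X]setTI.
  apply: measurable_fun_eqr => //.
  exact: measurableT_comp (measurable_qtl m) measurable_strict_cdf.
exists N; split => //; last by move=> u /eqP.
rewrite -(product_measure_fst m unif01 mN) -(measure0 (m \x unif01)).
apply: eq_measure_ae => //.
  rewrite -[X in measurable X]setTI; exact: measurable_fst.
have := qtl_dist_transform (Z := (idR : {RV m >-> R})) m_integrable.
apply: filterS => uv; rewrite dist_transformE => E.
split => //; rewrite /N /= => /eqP; apply; exact: E.
Qed.

End atomless.

Lemma ae_law d d' (T : measurableType d) (T' : measurableType d')
    (R : realType) (m : {measure set T -> \bar R})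
    (n : {measure set T' -> \bar R}) (f : T -> T') (Q : T' -> Prop) :
  measurable_fun [set: T] f ->
  (forall A, measurable A -> m (f @^-1` A) = n A) ->
  {ae n, forall y, Q y} -> {ae m, forall x, Q (f x)}.
Proof.
move=> mf mn [N [mN N0 QN]]; exists (f @^-1` N); split.
- by rewrite -[X in measurable X]setTI; exact: mf.
- by rewrite mn.
- by move=> x /= /QN.
Qed.

(** On a null set of the density the nonnegative [f] has zero integral, hence vanishes almost
    everywhere. *)
Lemma density_ae d (T : measurableType d) (R : realType)
    (mu : {measure set T -> \bar R}) (f : T -> R)
    (mf : measurable_fun [set: T] f) (f0 : forall x, 0 <= f x)
    (f1 : (\int[mu]_x (f x)%:E = 1)%E) (Q : T -> Prop) :
  {ae density mf f0 f1, forall x, Q x} -> {ae mu, forall x, 0 < f x -> Q x}.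
Proof.
move=> [N [mN N0 QN]].
have : ae_eq mu N (EFin \o f) (cst 0%E).
  apply/ae_eq_integral_abs => //; first exact/measurable_EFinP/measurable_funTS.
  rewrite -[RHS]N0; apply: eq_integral => x _.
  by rewrite gee0_abs// lee_fin.
apply: filterS => x Nx fx; apply: contrapT => /QN /Nx [] fx0.
by rewrite fx0 ltxx in fx.
Qed.

(** The zero set of [f] receives no mass. Applied to the target of a transport, this is the source
    of the strict inequalities between [x] and [y] at transported points. *)
Lemma ae_density d (T : measurableType d) (R : realType)
    (mu : {measure set T -> \bar R}) (f : T -> R)
    (mf : measurable_fun [set: T] f) (f0 : forall x, 0 <= f x)
    (f1 : (\int[mu]_x (f x)%:E = 1)%E) (Q : T -> Prop) :
  {ae mu, forall x, Q x} -> {ae density mf f0 f1, forall x, 0 < f x /\ Q x}.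
Proof.
move=> [N [mN N0 QN]].
have mf0 : measurable [set x | f x == 0].
  by rewrite -[X in measurable X]setTI; exact: measurable_fun_eqr.
have h1 : {ae density mf f0 f1, forall x, Q x}.
  exists N; split => //; apply: null_set_integral => //.
  exact/measurable_EFinP/measurable_funTS.
have h2 : {ae density mf f0 f1, forall x, 0 < f x}.
  exists [set x | f x == 0]; split => //.
    by apply: integral0_eq => x /= /eqP ->.
  by move=> x /= /negP; rewrite -leNgt => fx; rewrite eq_le fx f0.
exact: filterS2 h2 h1.
Qed.

Section transport.
Context {R : realType} (m1 m2 : probability R R).
Hypothesis m1_atomless : forall z, m1 [set z] = 0%E.
Hypothesis m1_integrable : m1.-integrable [set: R] EFin.
Hypothesis m2_atomless : forall z, m2 [set z] = 0%E.
Hypothesis m2_integrable : m2.-integrable [set: R] EFin.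
Local Open Scope ereal_scope.

(** The two laws are arguments, and not the fixed [m1] and [m2], because both directions are
    used. *)
Definition transport (m m' : probability R R) (u : R) : R :=
  qtl m' (strict_cdf m u).

Lemma measurable_transport (m m' : probability R R) : measurable_fun [set: R] (transport m m').
Proof. exact: measurableT_comp (measurable_qtl m') (measurable_strict_cdf m). Qed.

Lemma transport_law A : measurable A -> m1 (transport m1 m2 @^-1` A) = m2 A.
Proof.
move=> mA; rewrite -(qtl_law m2 mA) -(strict_cdf_law m1_atomless)//.
by rewrite -[X in measurable X]setTI; exact: measurable_qtl.
Qed.

(** At the level [s = strict_cdf m u], almost every [u] is [qtl m s]: the graph of the transport
    carries the comonotone coupling of [m] and [m']. *)
Let integral_transport_qtl (m m' : probability R R) (k : R * R -> \bar R) :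
  (forall z, m [set z] = 0) -> m.-integrable [set: R] EFin ->
  measurable_fun [set: R * R] k -> (forall z, 0 <= k z) ->
  \int[m]_u k (u, transport m m' u) = \int[unif01]_s k (qtl m s, qtl m' s).
Proof.
move=> m0 mi mk k0.
have mq (n n' : probability R R) : measurable_fun [set: R] (fun s => (qtl n s, qtl n' s)).
  by apply: measurable_fun_pair; exact: measurable_qtl.
rewrite -(@ge0_integral_law _ _ _ _ _ m unif01 (strict_cdf m) _ _
  (fun s => k (qtl m s, qtl m' s)))//; last 3 first.
- exact: measurable_strict_cdf.
- exact: strict_cdf_law.
- exact: measurableT_comp.
apply: ge0_ae_eq_integral => //.
- apply: measurableT_comp => //; apply: measurable_fun_pair => //.
  exact: measurable_transport.
- apply: (@measurableT_comp _ _ _ _ _ _ (fun s => k (qtl m s, qtl m' s))).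
    exact: measurableT_comp.
  exact: measurable_strict_cdf.
by apply: filterS (qtl_strict_cdf m0 mi) => u -> _.
Qed.

Let strict_cdf01 (m : probability R R) : (forall z, m [set z] = 0) ->
  {ae m, forall u, (0 < strict_cdf m u < 1)%R}.
Proof.
move=> m0; exists (strict_cdf m @^-1` (~` `]0%R, 1%R[%classic)); split.
- rewrite -[X in measurable X]setTI; apply: measurable_strict_cdf => //.
  exact: measurableC.
- rewrite strict_cdf_law//; last exact: measurableC.
  by rewrite probability_setC// unif01_oo subee.
- by move=> u /=; rewrite in_itv.
Qed.

Hypothesis m21 : forall t, m2 `]-oo, t]%classic <= m1 `]-oo, t]%classic.

Let qtl12 (s : R) : (0 < s < 1)%R -> (qtl m1 s <= qtl m2 s)%R.
Proof.
move=> s01; apply/(qtl_le m1 _ s01); apply: le_trans (m21 _).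
exact/(qtl_le m2 _ s01).
Qed.

(** Almost every [u] is the quantile of [m1] at its own level, and at a common level the quantile of
    [m2] lies further right. *)
Lemma transport_ge : {ae m1, forall u, (u <= transport m1 m2 u)%R}.
Proof.
apply: filterS2 (strict_cdf01 m1_atomless) (qtl_strict_cdf m1_atomless m1_integrable).
by move=> u u01 {1}<-; exact: qtl12.
Qed.

Lemma transport_le : {ae m2, forall u, (transport m2 m1 u <= u)%R}.
Proof.
apply: filterS2 (strict_cdf01 m2_atomless) (qtl_strict_cdf m2_atomless m2_integrable).
by move=> u u01 {2}<-; exact: qtl12.
Qed.

(** Both sides integrate [k] against the comonotone coupling. This expresses that the two transports
    invert each other, in the form needed to exchange mass. *)
Lemma integral_transport (k : R * R -> \bar R) :
  measurable_fun [set: R * R] k -> (forall z, 0 <= k z) ->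
  \int[m1]_u k (u, transport m1 m2 u) = \int[m2]_v k (transport m2 m1 v, v).
Proof.
move=> mk k0; rewrite integral_transport_qtl//.
rewrite (integral_transport_qtl m1 (k := fun z => k (z.2, z.1)))//.
by apply: measurableT_comp => //; exact: measurable_fun_pair.
Qed.

End transport.

Lemma integral_unif01_if (R : realType) (p a b : R) : 0 <= p <= 1 ->
  (\int[unif01]_w (if w < p then a else b)%:E = (p * a + (1 - p) * b)%:E)%E.
Proof.
move=> p01.
under eq_integral => w _.
  rewrite (_ : (if w < p then a else b) = b + (a - b) * \1_(`]-oo, p[%classic) w); last first.
    rewrite indicE; case: ltP => wp.
      by rewrite mem_set ?in_itv//= mulr1 addrC subrK.
    by rewrite memNset ?mulr0 ?addr0//= in_itv/= ltNge wp.
  rewrite EFinD EFinM.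
  over.
have i1 : unif01.-integrable [set: R] (fun w : R => (\1_(`]-oo, p[%classic) w)%:E).
  exact: integrable_indic.
rewrite integralD//; last 2 first.
- exact: finite_measure_integrable_cst.
- exact: integrableZl.
rewrite integralZl//.
rewrite (_ : (\int[_]_w (\1_ _ w)%:E)%E = p%:E); last first.
  by rewrite integral_indic// setIT; exact: unif01_itvNyo.
rewrite integral_cst_probability.
by rewrite -EFinM -EFinD; congr EFin; ring.
Qed.

(** * Martingale couplings *)

(* If [Y] equals [z u] with probability [p u] and [y u] otherwise, conditionally
   on a uniform [U = u], then [E(Y | U) = x U], and [Y] has the law of [y U]: by
   the last clause, the mass moved away from [y u] is exactly replaced by the
   mass moved to [z u]. *)
Definition is_splitting {R : realType} (x y p z : R -> R) : Prop :=
  [/\ measurable_fun [set: R] p, measurable_fun [set: R] z,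
      forall u, 0 <= p u,
      {ae unif01, forall u,
        0 <= p u <= 1 /\ p u * z u + (1 - p u) * y u = x u} &
      forall h : R -> \bar R, measurable_fun [set: R] h ->
        (forall r, 0 <= h r)%E ->
        (\int[unif01]_u ((p u)%:E * h (z u)) =
         \int[unif01]_u ((p u)%:E * h (y u)))%E].

Section splitting.
Context {R : realType} (x y : R -> R).
Hypothesis mx : measurable_fun [set: R] x.
Hypothesis my : measurable_fun [set: R] y.
Hypothesis ix : unif01.-integrable [set: R] (EFin \o x).
Hypothesis iy : unif01.-integrable [set: R] (EFin \o y).
Hypothesis x_nd : forall s t, 0 < s -> s <= t -> t < 1 -> x s <= x t.
Hypothesis xy0 : (\int[unif01]_u (x u - y u)%:E = 0)%E.
Hypothesis xy_ge0 : forall t,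
  (0 <= \int[unif01]_(u in `]-oo, t]) (x u - y u)%:E)%E.
Local Open Scope ereal_scope.

Let dp (u : R) : R := Num.max (x u - y u)%R 0%R.
Let dm (u : R) : R := Num.max (y u - x u)%R 0%R.

Let dpdm u : (dp u - dm u = x u - y u)%R.
Proof.
rewrite /dp /dm; case: (leP (x u - y u)%R 0%R) => h1;
  case: (leP (y u - x u)%R 0%R) => h2; lra.
Qed.

Let dp0 u : (0 <= dp u)%R. Proof. by rewrite le_max lexx orbT. Qed.
Let dm0 u : (0 <= dm u)%R. Proof. by rewrite le_max lexx orbT. Qed.

Let mxy : measurable_fun [set: R] (fun u => x u - y u)%R.
Proof. exact: measurable_funB. Qed.

Let mdp : measurable_fun [set: R] dp.
Proof. exact: measurable_maxr. Qed.

Let mdm : measurable_fun [set: R] dm.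
Proof. by apply: measurable_maxr => //; exact: measurable_funB. Qed.

Let ixy : unif01.-integrable [set: R] (fun u => (x u - y u)%:E).
Proof. exact: (integrableB measurableT ix iy). Qed.

Let idp : unif01.-integrable [set: R] (EFin \o dp).
Proof.
apply: (le_integrable _ _ _ ixy) => //; first exact/measurable_EFinP.
move=> u _; rewrite /= lee_fin ger0_norm// /dp.
by rewrite ge_max ler_norm normr_ge0.
Qed.

Let idm : unif01.-integrable [set: R] (EFin \o dm).
Proof.
apply: (le_integrable _ _ _ ixy) => //; first exact/measurable_EFinP.
move=> u _; rewrite /= lee_fin ger0_norm// /dm.
by rewrite distrC ge_max ler_norm normr_ge0.
Qed.

Let int_dpdm (D : set R) : measurable D ->
  \int[unif01]_(u in D) (x u - y u)%:E =
  \int[unif01]_(u in D) (dp u)%:E - \int[unif01]_(u in D) (dm u)%:E.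
Proof.
move=> mD; rewrite -integralB//; last 2 first.
- exact: integrableS idp.
- exact: integrableS idm.
by apply: eq_integral => u _; rewrite -dpdm.
Qed.

Let dpm : \int[unif01]_u (dp u)%:E = \int[unif01]_u (dm u)%:E.
Proof.
have := xy0; rewrite int_dpdm//.
have /fineK <- : \int[unif01]_u (dp u)%:E \is a fin_num by exact: integrable_fin_num.
have /fineK <- : \int[unif01]_u (dm u)%:E \is a fin_num by exact: integrable_fin_num.
by rewrite -EFinB => /eqP; rewrite eqe subr_eq0 => /eqP ->.
Qed.

Let dpm_le t : \int[unif01]_(u in `]-oo, t]) (dm u)%:E <=
               \int[unif01]_(u in `]-oo, t]) (dp u)%:E.
Proof.
have := xy_ge0 t; rewrite int_dpdm// sube_ge0//.
by apply/orP; left; apply: integrable_fin_num => //; exact: integrableS idm.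
Qed.

Section paired.
Variables a b : R -> R.
Hypothesis ma : measurable_fun [set: R] a.
Hypothesis mb : measurable_fun [set: R] b.
Hypothesis int_ab : forall k : R * R -> \bar R,
  measurable_fun [set: R * R] k -> (forall uv, 0 <= k uv) ->
  \int[unif01]_u ((dp u)%:E * k (u, a u)) =
  \int[unif01]_v ((dm v)%:E * k (b v, v)).
Hypothesis up : {ae unif01, forall u, (y u < x u)%R ->
  [/\ (u <= a u)%R, (a u < 1)%R & (x (a u) < y (a u))%R]}.
Hypothesis down : {ae unif01, forall u, (x u < y u)%R ->
  [/\ (b u <= u)%R, (0 < b u)%R & (y (b u) < x (b u))%R]}.

(** The inverse length of the jump from [y u] to [y v], so that [(x u - y u) * D (u, v)] is the
    probability of that jump needed to reach the mean [x u]. The default value 0 keeps it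
    nonnegative everywhere. *)
Let D (uv : R * R) : R := if (y uv.1 < y uv.2)%R then (y uv.2 - y uv.1)^-1%R else 0%R.

Let D0 uv : (0 <= D uv)%R.
Proof. by rewrite /D; case: ifPn => // h; rewrite invr_ge0 subr_ge0 ltW. Qed.

Let mD : measurable_fun [set: R * R] D.
Proof.
have m1 : measurable_fun [set: R * R] (fun uv : R * R => y uv.1).
  by apply: measurableT_comp => //; exact: measurable_fst.
have m2 : measurable_fun [set: R * R] (fun uv : R * R => y uv.2).
  by apply: measurableT_comp => //; exact: measurable_snd.
(* The inverse is written as a real power, which is a measurable function. *)
rewrite (_ : D = fun uv => if (y uv.1 < y uv.2)%R
    then ((y uv.2 - y uv.1) `^ (-1))%R else 0%R); last first.
  apply/funext => uv; rewrite /D; case: ifPn => // yy.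
  by rewrite powR_inv1// subr_ge0 ltW.
apply: measurable_fun_ifT => //; first exact: measurable_fun_ltr.
apply: (measurableT_comp (measurable_powR _)); exact: measurable_funB.
Qed.

(** At most one summand is nonzero, since [dp] and [dm] are not both positive; the sum form lets
    each direction be integrated separately. *)
Let p u : R := (dp u * D (u, a u) + dm u * D (b u, u))%R.
Let z u : R := if (y u < x u)%R then y (a u) else y (b u).

Let mpa : measurable_fun [set: R] (fun u => (u, a u)).
Proof. exact: (measurable_fun_pair (@measurable_id _ _ setT) ma). Qed.

Let mpb : measurable_fun [set: R] (fun u => (b u, u)).
Proof. exact: (measurable_fun_pair mb (@measurable_id _ _ setT)). Qed.

(** [p u] is the barycentric coordinate of [x u] on the segment from [y u] to [z u]. Monotonicity of
    [x] between [u] and its partner is what places [x u] on this segment. *)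
Let pz : {ae unif01, forall u,
  (0 <= p u <= 1)%R /\ (p u * z u + (1 - p u) * y u = x u)%R}.
Proof.
apply: filterS3 ae_unif01 up down => u /andP[u0 u1] upu downu.
rewrite /p /z /dp /dm.
case: (ltgtP (y u) (x u)) => [yx|xy|yx].
- have [ua a1 xa] := upu yx.
  have d0 : (0 < y (a u) - y u)%R.
    by have := x_nd u0 ua a1; lra.
  have -> : Num.max (x u - y u)%R 0%R = (x u - y u)%R.
    by rewrite max_l// subr_ge0 ltW.
  have -> : Num.max (y u - x u)%R 0%R = 0%R by rewrite max_r// subr_le0 ltW.
  rewrite mul0r addr0.
  rewrite /D/= -subr_gt0 d0/=; split.
    rewrite divr_ge0 ?(ltW d0) ?subr_ge0 ?(ltW yx)//= ler_pdivrMr// mul1r.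
    by have := x_nd u0 ua a1; lra.
  by field; rewrite gt_eqF.
- have [bu b1 xb] := downu xy.
  have d0 : (0 < y u - y (b u))%R.
    by have := x_nd b1 bu u1; lra.
  have -> : Num.max (y u - x u)%R 0%R = (y u - x u)%R.
    by rewrite max_l// subr_ge0 ltW.
  have -> : Num.max (x u - y u)%R 0%R = 0%R by rewrite max_r// subr_le0 ltW.
  rewrite mul0r add0r.
  rewrite /D/= -subr_gt0 d0/=; split.
    rewrite divr_ge0 ?(ltW d0) ?subr_ge0 ?(ltW xy)//= ler_pdivrMr// mul1r.
    by have := x_nd b1 bu u1; lra.
  by field; rewrite gt_eqF.
- rewrite yx subrr maxxx !mul0r addr0 lexx ler01; split => //.
  by rewrite mul0r subr0 mul1r add0r.
Qed.

(** [e1] turns the mass that arrives by upward jumps into the mass that leaves by downward jumps,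
    and [e2] does the reverse; after both, only departures remain. *)
Let pzy (h : R -> \bar R) : measurable_fun [set: R] h -> (forall r, 0 <= h r) ->
  \int[unif01]_u ((p u)%:E * h (z u)) = \int[unif01]_u ((p u)%:E * h (y u)).
Proof.
move=> mh h0.
have mk1 : measurable_fun [set: R * R] (fun uv : R * R => (D uv)%:E * h (y uv.2)).
  apply: emeasurable_funM; first exact/measurable_EFinP.
  exact: (measurableT_comp mh (measurableT_comp my measurable_snd)).
have mk2 : measurable_fun [set: R * R] (fun uv : R * R => (D uv)%:E * h (y uv.1)).
  apply: emeasurable_funM; first exact/measurable_EFinP.
  exact: (measurableT_comp mh (measurableT_comp my measurable_fst)).
have k0 uv (r : R) : 0 <= (D uv)%:E * h r by rewrite mule_ge0 ?lee_fin.
have mdk (f : R -> R) (k : R * R -> \bar R) (w : R -> R * R) :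
    measurable_fun [set: R] f -> measurable_fun [set: R * R] k ->
    measurable_fun [set: R] w ->
    measurable_fun [set: R] (fun u => (f u)%:E * k (w u)).
  move=> mf mk mw; apply: emeasurable_funM; first exact/measurable_EFinP.
  exact: (measurableT_comp mk mw).
have e1 := int_ab mk1 (fun uv => k0 uv (y uv.2)).
have e2 := int_ab mk2 (fun uv => k0 uv (y uv.1)).
transitivity (\int[unif01]_u ((dp u)%:E * ((D (u, a u))%:E * h (y (a u))) +
                              (dm u)%:E * ((D (b u, u))%:E * h (y (b u))))).
  apply: eq_integral => u _; rewrite /p /z EFinD ge0_muleDl; last 2 first.
  - by rewrite lee_fin mulr_ge0.
  - by rewrite lee_fin mulr_ge0.
  rewrite !EFinM !muleA /dp /dm.
  case: (ltgtP (y u) (x u)) => [yx|xy|yx].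
  - have -> : Num.max (y u - x u)%R 0%R = 0%R by rewrite max_r// subr_le0 ltW.
    by rewrite !mul0e.
  - have -> : Num.max (x u - y u)%R 0%R = 0%R by rewrite max_r// subr_le0 ltW.
    by rewrite !mul0e.
  - by rewrite yx subrr maxxx !mul0e.
rewrite ge0_integralD//; last 4 first.
- by move=> u _; rewrite mule_ge0 ?lee_fin.
- exact: (mdk _ _ _ mdp mk1 mpa).
- by move=> u _; rewrite mule_ge0 ?lee_fin.
- exact: (mdk _ _ _ mdm mk2 mpb).
rewrite e1 -e2 addeC -ge0_integralD//; last 4 first.
- by move=> u _; rewrite mule_ge0 ?lee_fin.
- exact: (mdk _ _ _ mdp mk2 mpa).
- by move=> u _; rewrite mule_ge0 ?lee_fin.
- exact: (mdk _ _ _ mdm mk1 mpb).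
apply: eq_integral => u _; rewrite /p EFinD ge0_muleDl ?lee_fin ?mulr_ge0//.
by rewrite !EFinM !muleA.
Qed.

Lemma splitting_paired : exists p z, is_splitting x y p z.
Proof.
have mya := measurableT_comp my ma.
have myb := measurableT_comp my mb.
exists p, z; split => //.
- apply: measurable_funD; apply: measurable_funM => //.
    exact: (measurableT_comp mD mpa).
  exact: (measurableT_comp mD mpb).
- by apply: measurable_fun_ifT => //; exact: measurable_fun_ltr.
- by move=> u; rewrite addr_ge0// mulr_ge0.
Qed.

End paired.

(** The common mass of [dp] and [dm], by which they are normalised to probability densities when it
    is positive. *)
Let M : R := fine (\int[unif01]_u (dp u)%:E).

Let ME : M%:E = \int[unif01]_u (dp u)%:E.
Proof. by rewrite fineK//; exact: integrable_fin_num. Qed.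

Section positive_mass.
Hypothesis M0 : (0 < M)%R.

Let fp u : R := (M^-1 * dp u)%R.
Let fm u : R := (M^-1 * dm u)%R.

Let fp0 u : (0 <= fp u)%R. Proof. by rewrite mulr_ge0// invr_ge0 ltW. Qed.
Let fm0 u : (0 <= fm u)%R. Proof. by rewrite mulr_ge0// invr_ge0 ltW. Qed.
Let mfp : measurable_fun [set: R] fp. Proof. exact: measurable_funM. Qed.
Let mfm : measurable_fun [set: R] fm. Proof. exact: measurable_funM. Qed.

Let fp1 : \int[unif01]_u (fp u)%:E = 1.
Proof.
under eq_integral do rewrite EFinM.
by rewrite integralZl// -ME -EFinM mulVf// gt_eqF.
Qed.

Let fm1 : \int[unif01]_u (fm u)%:E = 1.
Proof.
under eq_integral do rewrite EFinM.
by rewrite integralZl// -dpm -ME -EFinM mulVf// gt_eqF.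
Qed.

Let mp : probability R R := density mfp fp0 fp1.
Let mm : probability R R := density mfm fm0 fm1.

Let unif01_set1 (z : R) : unif01 [set z] = 0.
Proof.
rewrite (@eq_unif01 _ _ ([set z] `&` `]0%R, 1%R[%classic))//; last 2 first.
- exact: measurableI.
- by move=> u u01/=; split => [uz|[]//]; split => //; rewrite in_itv.
rewrite unif01E//; last 2 first.
- exact: measurableI.
- by move=> u [_]; exact: subset_itv_oo_cc.
apply: (subset_measure0 _ _ (@subIsetl _ _ _)) => //; last exact: lebesgue_measure_set1.
exact: measurableI.
Qed.

Let density_atomless f (mf : measurable_fun [set: R] f) f0
  (f1 : \int[unif01]_u (f u)%:E = 1) z : density mf f0 f1 [set z] = 0.
Proof.
apply: null_set_integral => //; last exact: unif01_set1.
exact/measurable_EFinP/measurable_funTS.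
Qed.

(** The density is carried by the unit interval, where the identity is bounded by 1. *)
Let density_integrable f (mf : measurable_fun [set: R] f) f0
  (f1 : \int[unif01]_u (f u)%:E = 1) :
  (density mf f0 f1).-integrable [set: R] EFin.
Proof.
apply/integrableP; split; first exact/measurable_EFinP.
apply: (@le_lt_trans _ _ (\int[density mf f0 f1]_u 1)).
  apply: ae_ge0_le_integral => //.
    by apply: measurableT_comp => //; exact/measurable_EFinP.
  apply: filterS (ae_density mf f0 f1 ae_unif01) => u [_ /andP[u0 u1]] _.
  by rewrite lee_fin ger0_norm ltW.
by rewrite integral_cst// mul1e (le_lt_trans (probability_le1 _ _)) ?ltry.
Qed.

Let mpm t : mm `]-oo, t]%classic <= mp `]-oo, t]%classic.
Proof.
have E (f : R -> R) : measurable_fun [set: R] f -> (forall u, 0 <= f u)%R ->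
    \int[unif01]_(u in `]-oo, t]) (M^-1 * f u)%:E =
    M^-1%:E * \int[unif01]_(u in `]-oo, t]) (f u)%:E.
  move=> mf f0; under eq_integral do rewrite EFinM.
  rewrite ge0_integralZl_EFin//.
  - by move=> u _; rewrite lee_fin.
  - exact/measurable_EFinP/measurable_funTS.
  - by rewrite invr_ge0 ltW.
rewrite /mm /mp !densityE !E// lee_wpmul2l// lee_fin invr_ge0 ltW//.
Qed.

Let atomless_p := density_atomless mfp fp0 fp1.
Let atomless_m := density_atomless mfm fm0 fm1.
Let integrable_p := density_integrable mfp fp0 fp1.
Let integrable_m := density_integrable mfm fm0 fm1.

Let a0 := transport mp mm.
Let b0 := transport mm mp.

Let ma0 : measurable_fun [set: R] a0. Proof. exact: measurable_transport. Qed.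
Let mb0 : measurable_fun [set: R] b0. Proof. exact: measurable_transport. Qed.

Let int_ab (k : R * R -> \bar R) : measurable_fun [set: R * R] k ->
  (forall uv, 0 <= k uv) ->
  \int[unif01]_u ((dp u)%:E * k (u, a0 u)) =
  \int[unif01]_v ((dm v)%:E * k (b0 v, v)).
Proof.
move=> mk k0.
have mka : measurable_fun [set: R] (fun u => k (u, a0 u)).
  exact: (measurableT_comp mk
    (measurable_fun_pair (@measurable_id _ _ setT) ma0)).
have mkb : measurable_fun [set: R] (fun u => k (b0 u, u)).
  exact: (measurableT_comp mk
    (measurable_fun_pair mb0 (@measurable_id _ _ setT))).
have E (f : R -> R) (h : R -> \bar R) : measurable_fun [set: R] f ->
    (forall u, 0 <= f u)%R -> measurable_fun [set: R] h -> (forall u, 0 <= h u) ->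
    \int[unif01]_u ((f u)%:E * h u) = M%:E * \int[unif01]_u ((M^-1 * f u)%:E * h u).
  move=> mf f0 mh h0; rewrite -ge0_integralZl_EFin//.
  - apply: eq_integral => u _; rewrite muleA -EFinM mulrA mulfV ?mul1r//.
    by rewrite gt_eqF.
  - by move=> u _; rewrite mule_ge0// lee_fin mulr_ge0// invr_ge0 ltW.
  - apply: emeasurable_funM => //; apply/measurable_EFinP.
    exact: measurable_funM.
  - exact: ltW.
rewrite (E _ _ mdp dp0 mka (fun=> k0 _)) (E _ _ mdm dm0 mkb (fun=> k0 _)).
congr (_ * _).
apply: etrans (esym (ge0_integral_density mfp fp0 fp1 mka (fun=> k0 _))) _.
apply: etrans (ge0_integral_density mfm fm0 fm1 mkb (fun=> k0 _)).
exact: (integral_transport atomless_p integrable_p atomless_m integrable_m mk k0).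
Qed.

Let fp_gt0 u : (0 < fp u)%R = (y u < x u)%R.
Proof. by rewrite pmulr_rgt0 ?invr_gt0// lt_max ltxx orbF subr_gt0. Qed.

Let fm_gt0 u : (0 < fm u)%R = (x u < y u)%R.
Proof. by rewrite pmulr_rgt0 ?invr_gt0// lt_max ltxx orbF subr_gt0. Qed.

(** The inequality [u <= a0 u] comes from the order of the cdfs. The other two hold because [a0 u]
    has law [mm], carried by the points of the unit interval where [x < y]. The statement for [mp]
    is then read under the uniform law, where [mp] has positive density. *)
Let up : {ae unif01, forall u, (y u < x u)%R ->
  [/\ (u <= a0 u)%R, (a0 u < 1)%R & (x (a0 u) < y (a0 u))%R]}.
Proof.
have h : {ae mp, forall u,
    [/\ (u <= a0 u)%R, (a0 u < 1)%R & (x (a0 u) < y (a0 u))%R]}.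
  have h1 := transport_ge atomless_p integrable_p mpm.
  have h2 := ae_law ma0 (transport_law mm atomless_p)
               (ae_density mfm fm0 fm1 ae_unif01).
  by apply: filterS2 h1 h2 => u ua [+ /andP[_ a1]]; rewrite fm_gt0.
by apply: filterS (density_ae h) => u; rewrite fp_gt0.
Qed.

Let down : {ae unif01, forall u, (x u < y u)%R ->
  [/\ (b0 u <= u)%R, (0 < b0 u)%R & (y (b0 u) < x (b0 u))%R]}.
Proof.
have h : {ae mm, forall u,
    [/\ (b0 u <= u)%R, (0 < b0 u)%R & (y (b0 u) < x (b0 u))%R]}.
  have h1 := transport_le atomless_m integrable_m mpm.
  have h2 := ae_law mb0 (transport_law mp atomless_m)
               (ae_density mfp fp0 fp1 ae_unif01).
  by apply: filterS2 h1 h2 => u ua [+ /andP[b1 _]]; rewrite fp_gt0.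
by apply: filterS (density_ae h) => u; rewrite fm_gt0.
Qed.

Lemma splitting_pos : exists p z, is_splitting x y p z.
Proof. exact: (splitting_paired ma0 mb0 int_ab up down). Qed.

End positive_mass.

Lemma splitting : exists p z, is_splitting x y p z.
Proof.
have [M0|M0] := ltP 0%R M; first exact: splitting_pos.
have {}M0 : M = 0%R.
  apply/le_anti; rewrite M0/= fine_ge0// integral_ge0// => u _.
  by rewrite lee_fin.
(* There is no mass to move: [x] and [y] agree almost everywhere, the jump probability is 0 and the
   target is arbitrary. *)
exists (cst 0%R), (cst 0%R); split => //; last first.
  move=> h _ _; apply: eq_integral => u _; by rewrite !mul0e.
have ae0 (f : R -> R) : measurable_fun [set: R] f -> (forall u, 0 <= f u)%R ->
    \int[unif01]_u (f u)%:E = 0 -> {ae unif01, forall u, f u = 0%R}.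
  move=> mf f0 If; have : ae_eq unif01 setT (EFin \o f) (cst 0).
    apply/ae_eq_integral_abs => //; first exact/measurable_EFinP.
    by rewrite -[RHS]If; apply: eq_integral => u _; rewrite gee0_abs// lee_fin.
  by apply: filterS => u /(_ I) [].
apply: filterS2 (ae0 _ mdp dp0 _) (ae0 _ mdm dm0 _) => [u du mu||].
- by rewrite lexx ler01 mul0r subr0 mul1r add0r; split => //; have := dpdm u; lra.
- by rewrite -ME M0.
- by rewrite -dpm -ME M0.
Qed.

End splitting.

Section martingale_kernel.
Context {R : realType} (x y : R -> R).
Hypothesis mx : measurable_fun [set: R] x.
Hypothesis my : measurable_fun [set: R] y.
Hypothesis ix : unif01.-integrable [set: R] (EFin \o x).
Hypothesis iy : unif01.-integrable [set: R] (EFin \o y).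
Hypothesis x_nd : forall s t, 0 < s -> s <= t -> t < 1 -> x s <= x t.
Hypothesis xy0 : (\int[unif01]_u (x u - y u)%:E = 0)%E.
Hypothesis xy_ge0 : forall t,
  (0 <= \int[unif01]_(u in `]-oo, t]) (x u - y u)%:E)%E.
Local Open Scope ereal_scope.

(** The second coordinate is a coin of bias [p u] that chooses between [z u] and [y u]. For the law,
    the last clause of [is_splitting] replaces [p h(z)] by [p h(y)], which completes [(1 - p) h(y)]
    to [h(y)]. *)
Lemma martingale_kernel : exists g : R * R -> R,
  [/\ measurable_fun [set: R * R] g,
      {ae unif01, forall u, \int[unif01]_w (g (u, w))%:E = (x u)%:E},
      {ae unif01, forall u, (x u ^+ 2)%:E <= \int[unif01]_w (g (u, w) ^+ 2)%:E} &
      forall A, measurable A ->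
        (unif01 \x unif01) (g @^-1` A) = unif01 (y @^-1` A)].
Proof.
have [p [z [mp mz p0 pz pzy]]] := splitting mx my ix iy x_nd xy0 xy_ge0.
pose g (uw : R * R) : R := if (uw.2 < p uw.1)%R then z uw.1 else y uw.1.
have mg : measurable_fun [set: R * R] g.
  apply: measurable_fun_ifT.
  - apply: measurable_fun_ltr => //.
    exact: (measurableT_comp mp measurable_fst).
  - exact: (measurableT_comp mz measurable_fst).
  - exact: (measurableT_comp my measurable_fst).
have gE (f : R -> R) u : (0 <= p u <= 1)%R ->
    \int[unif01]_w (f (g (u, w)))%:E = (p u * f (z u) + (1 - p u) * f (y u))%:E.
  move=> pu; rewrite -integral_unif01_if//; apply: eq_integral => w _.
  by rewrite /g/=; case: ifPn.
exists g; split => //.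
- by apply: filterS pz => u [pu <-]; rewrite (gE id).
- apply: filterS pz => u [pu <-]; rewrite (gE (fun r => r ^+ 2)%R)// lee_fin.
  have /andP[pu0 pu1] := pu.
  (* The gap in Jensen's inequality is the variance of the two-point law. *)
  rewrite -subr_ge0 (_ : _ - _ = p u * (1 - p u) * (z u - y u) ^+ 2)%R; last ring.
  by rewrite mulr_ge0 ?sqr_ge0// mulr_ge0// subr_ge0.
move=> A mA.
have mgA : measurable (g @^-1` A).
  by rewrite -[X in measurable X]setTI; exact: mg.
have myA : measurable (y @^-1` A).
  by rewrite -[X in measurable X]setTI; exact: my.
pose h (r : R) : \bar R := (\1_A r)%:E.
have mh : measurable_fun [set: R] h by exact/measurable_EFinP.
have h0 r : 0 <= h r by rewrite lee_fin.
(* The bound [p u <= 1] holds only almost everywhere; truncating [1 - p] keeps all integrands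
   nonnegative. *)
pose q u : R := Num.max (1 - p u)%R 0%R.
have q0 u : (0 <= q u)%R by rewrite le_max lexx orbT.
have mq : measurable_fun [set: R] q.
  by apply: measurable_maxr => //; exact: measurable_funB.
have mhy : measurable_fun [set: R] (fun u => h (y u)) by exact: measurableT_comp.
have mhz : measurable_fun [set: R] (fun u => h (z u)) by exact: measurableT_comp.
have mM (f : R -> R) (k : R -> \bar R) : measurable_fun [set: R] f ->
    measurable_fun [set: R] k -> measurable_fun [set: R] (fun u => (f u)%:E * k u).
  by move=> mf mk; apply: emeasurable_funM => //; exact/measurable_EFinP.
have -> : (unif01 \x unif01) (g @^-1` A) = \int[unif01 \x unif01]_uw h (g uw).
  by rewrite /h (@integral_indic _ _ _ _ setT measurableT _ mgA) setIT.
have -> : unif01 (y @^-1` A) = \int[unif01]_u h (y u).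
  by rewrite /h (@integral_indic _ _ _ _ setT measurableT _ myA) setIT.
have mhg : measurable_fun [set: R * R] (fun uw => h (g uw)).
  exact: (measurableT_comp mh mg).
rewrite fubini_tonelli1//.
rewrite /fubini_F.
transitivity (\int[unif01]_u ((p u)%:E * h (z u) + (q u)%:E * h (y u))).
  apply: ge0_ae_eq_integral => //.
  - exact: (measurable_fun_fubini_tonelli_F _ mhg (fun uw => h0 (g uw))).
  - by apply: emeasurable_funD; exact: mM.
  - by move=> u _; exact: integral_ge0.
  - by move=> u _; rewrite adde_ge0 ?mule_ge0 ?lee_fin.
  apply: filterS pz => u [pu _] _; rewrite gE// EFinD !EFinM.
  by rewrite /q max_l// subr_ge0; case/andP: pu.
rewrite ge0_integralD//; last 4 first.
- by move=> u _; rewrite mule_ge0 ?lee_fin.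
- exact: mM.
- by move=> u _; rewrite mule_ge0 ?lee_fin.
- exact: mM.
rewrite pzy// -ge0_integralD//; last 4 first.
- by move=> u _; rewrite mule_ge0 ?lee_fin.
- exact: mM.
- by move=> u _; rewrite mule_ge0 ?lee_fin.
- exact: mM.
apply: ge0_ae_eq_integral => //.
- by apply: emeasurable_funD; exact: mM.
- by move=> u _; rewrite adde_ge0 ?mule_ge0 ?lee_fin.
apply: filterS pz => u [/andP[pu0 pu1] _] _.
rewrite -ge0_muleDl ?lee_fin// -EFinD /q max_l ?subr_ge0//.
by rewrite addrC subrK mul1e.
Qed.

End martingale_kernel.

(** * A kernel on the unit square from ordered tails *)

Section strassen.
Context {R : realType} (mu nu : probability R R).
Hypothesis mu_integrable : mu.-integrable [set: R] EFin.
Hypothesis nu_integrable : nu.-integrable [set: R] EFin.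
Local Open Scope ereal_scope.
Hypothesis mean_eq : \int[mu]_r r%:E = \int[nu]_r r%:E.
Hypothesis tail_le : forall a, (0 < a < 1)%R ->
  \int[unif01]_(u in `]a, +oo[) (qtl mu u)%:E <=
  \int[unif01]_(u in `]a, +oo[) (qtl nu u)%:E.

Let x := qtl mu.
Let y := qtl nu.

Let ix : unif01.-integrable [set: R] (EFin \o x).
Proof. exact: (integrable_law (measurable_qtl mu) (qtl_law mu)). Qed.

Let iy : unif01.-integrable [set: R] (EFin \o y).
Proof. exact: (integrable_law (measurable_qtl nu) (qtl_law nu)). Qed.

Let mxy : measurable_fun [set: R] (fun u => (x u - y u)%:E).
Proof.
by apply/measurable_EFinP; apply: measurable_funB; exact: measurable_qtl.
Qed.

Let int_xy (D : set R) : measurable D ->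
  \int[unif01]_(u in D) (x u - y u)%:E =
  \int[unif01]_(u in D) (x u)%:E - \int[unif01]_(u in D) (y u)%:E.
Proof.
move=> mD; rewrite -integralB//; last 2 first.
- exact: integrableS ix.
- exact: integrableS iy.
Qed.

Let ixy : unif01.-integrable [set: R] (fun u => (x u - y u)%:E).
Proof. exact: (integrableB measurableT ix iy). Qed.

Let xy0 : \int[unif01]_u (x u - y u)%:E = 0.
Proof.
rewrite int_xy//.
rewrite (integral_law (measurable_qtl mu) (qtl_law mu) (h := EFin))//.
rewrite (integral_law (measurable_qtl nu) (qtl_law nu) (h := EFin))//.
by rewrite mean_eq subee//; exact: integrable_fin_num.
Qed.

(** The integral over the complementary upper half-line is nonpositive by [tail_le], and the total
    is zero by equality of the means. *)
Let xy_ge0 t : 0 <= \int[unif01]_(u in `]-oo, t]) (x u - y u)%:E.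
Proof.
have [t0|t0] := leP t 0%R.
  rewrite (@eq_integral_unif01 _ _ set0)// ?integral_set0// => u /andP[u0 _].
  by rewrite /= in_itv/= leNgt (le_lt_trans t0 u0).
have [t1|t1] := ltP t 1%R; last first.
  rewrite (@eq_integral_unif01 _ _ setT)// ?xy0// => u /andP[_ u1].
  by rewrite /= in_itv/= (le_trans (ltW u1) t1).
have : \int[unif01]_(u in `]-oo, t] `|` `]t, +oo[) (x u - y u)%:E = 0.
  rewrite -[RHS]xy0; apply: eq_integral_unif01 => // [|u _].
    exact: measurableU.
  by rewrite /= !in_itv/= andbT; split => // _; case: (leP u t); [left|right].
rewrite integral_setU//; last 2 first.
- exact: measurable_funTS.
- apply/disj_setPS => u [/=]; rewrite !in_itv/= andbT => ut tu.
  by have := le_lt_trans ut tu; rewrite ltxx.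
have : \int[unif01]_(u in `]t, +oo[) (x u - y u)%:E <= 0.
  rewrite int_xy// sube_le0; exact: tail_le (introT andP (conj t0 t1)).
have /fineK <- : \int[unif01]_(u in `]-oo, t]) (x u - y u)%:E \is a fin_num.
  by apply: integrable_fin_num => //; exact: integrableS ixy.
have /fineK <- : \int[unif01]_(u in `]t, +oo[) (x u - y u)%:E \is a fin_num.
  by apply: integrable_fin_num => //; exact: integrableS ixy.
by rewrite -EFinD !lee_fin => h [] h'; lra.
Qed.

(** This kernel depends only on the two laws; it serves both the coupling over [T] and, through its
    second moment clause, the variance bound. *)
Lemma strassen_unif01 : exists g : R * R -> R,
  [/\ measurable_fun [set: R * R] g,
      {ae unif01, forall u, \int[unif01]_w (g (u, w))%:E = (qtl mu u)%:E},
      {ae unif01, forall u, (qtl mu u ^+ 2)%:E <= \int[unif01]_w (g (u, w) ^+ 2)%:E} &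
      forall A, measurable A -> (unif01 \x unif01) (g @^-1` A) = nu A].
Proof.
have [g [mg g1 g2 gl]] := martingale_kernel (measurable_qtl mu) (measurable_qtl nu) ix iy
  (qtl_nd mu) xy0 xy_ge0.
by exists g; split => // A mA; rewrite gl// qtl_law.
Qed.

End strassen.

(** * Coupling over an extension of the given probability space *)

Section martingale_coupling.
Context d {T : measurableType d} {R : realType} (P : probability T R).
Variables (Z : {RV P >-> R}) (nu : probability R R).
Local Open Scope ereal_scope.
Hypothesis iZ : P.-integrable [set: T] (EFin \o Z).
Hypothesis nu_integrable : nu.-integrable [set: R] EFin.
Hypothesis mean_eq : \int[P]_t (Z t)%:E = \int[nu]_r r%:E.
Hypothesis tail_le : forall a, (0 < a < 1)%R ->
  \int[unif01]_(u in `]a, +oo[) (qtl (distribution P Z) u)%:E <=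
  \int[unif01]_(u in `]a, +oo[) (qtl nu u)%:E.

Let mu : probability R R := distribution P Z.
Let P' : probability (T * R * R)%type R := (P \x unif01) \x unif01.
Let U := dist_transform Z.

Let mu_integrable : mu.-integrable [set: R] EFin.
Proof. exact: integrable_distribution. Qed.

Let mean_mu : \int[mu]_r r%:E = \int[nu]_r r%:E.
Proof. by rewrite -mean_eq integral_distribution. Qed.

(** The kernel is evaluated at the distributional transform of [Z] and at a fresh uniform variable.
    The set [A] is an arbitrary event of [T], not only one of [Z]: this is what lets the coupling
    carry the whole vector [X]. *)
Lemma martingale_coupling : exists Y' : T * R * R -> R,
  [/\ measurable_fun [set: T * R * R] Y',
      forall A, measurable A -> P' (Y' @^-1` A) = nu A &
      forall A, measurable A ->
        \int[P']_(s in (fst \o fst) @^-1` A) (Y' s)%:E = \int[P]_(t in A) (Z t)%:E].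
Proof.
have [g [mg g1 _ gl]] := strassen_unif01 mu_integrable nu_integrable mean_mu tail_le.
have mU : measurable_fun [set: T * R] U := measurable_dist_transform Z.
pose U2 (s : T * R * R) : R * R := (U s.1, s.2).
have mU2 : measurable_fun [set: T * R * R] U2.
  apply: measurable_fun_pair => //.
  exact: (measurableT_comp mU measurable_fst).
(* Integrating out the last coordinate first leaves a function of [U] alone, whose law is
   uniform. *)
have U2l A : measurable A -> P' (U2 @^-1` A) = (unif01 \x unif01) A.
  move=> mA.
  have mUA : measurable (U2 @^-1` A).
    by rewrite -[X in measurable X]setTI; exact: mU2.
  pose h (r : R * R) : \bar R := (\1_A r)%:E.
  have mh : measurable_fun [set: R * R] h by exact/measurable_EFinP.
  have h0 r : 0 <= h r by rewrite lee_fin.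
  have -> : P' (U2 @^-1` A) = \int[P']_s h (U2 s).
    by rewrite /h (@integral_indic _ _ _ _ setT measurableT _ mUA) setIT.
  have -> : (unif01 \x unif01) A = \int[unif01 \x unif01]_uw h uw.
    by rewrite /h (@integral_indic _ _ _ _ setT measurableT _ mA) setIT.
  have mhU : measurable_fun [set: T * R * R] (fun s => h (U2 s)).
    exact: (measurableT_comp mh mU2).
  rewrite fubini_tonelli1// [RHS]fubini_tonelli1//.
  have mF : measurable_fun [set: R] (fubini_F unif01 h).
    exact: (measurable_fun_fubini_tonelli_F _ mh h0).
  have F0 u : 0 <= fubini_F unif01 h u by exact: integral_ge0.
  exact: (ge0_integral_law mU (dist_transform_law Z) mF F0).
pose Y' s := g (U2 s).
have mY' : measurable_fun [set: T * R * R] Y' by exact: (measurableT_comp mg mU2).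
have lY' A : measurable A -> P' (Y' @^-1` A) = nu A.
  move=> mA; rewrite -(gl _ mA) -U2l//.
  by rewrite -[X in measurable X]setTI; exact: mg.
exists Y'; split => // A mA.
have iY' : P'.-integrable [set: T * R * R] (EFin \o Y').
  exact: (integrable_law mY' lY').
have mA' : measurable ((fst \o fst) @^-1` A : set (T * R * R)).
  rewrite -[X in measurable X]setTI.
  exact: (measurableT_comp measurable_fst measurable_fst).
pose f (s : T * R * R) : \bar R := (\1_A s.1.1 * Y' s)%:E.
have fE : f = (EFin \o Y') \_ ((fst \o fst) @^-1` A).
  apply/funext => s; rewrite /f patchE indicE.
  have -> : (s \in (fst \o fst) @^-1` A) = (s.1.1 \in A).
    by apply/idP/idP; rewrite !inE.
  by case: (s.1.1 \in A); rewrite ?mul1r ?mul0r.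
have if' : P'.-integrable [set: T * R * R] f.
  rewrite fE; apply: (integrable_mkcond _ mA').1.
  exact: (integrableS measurableT mA' _ iY').
rewrite integral_mkcond -fE -integral12_prod_meas1//.
have mZ1 : measurable_fun [set: T * R] (fun tv : T * R => (\1_A tv.1 * Z tv.1)%:E).
  apply/measurable_EFinP; apply: measurable_funM.
    exact: (measurableT_comp (measurable_indic mA) measurable_fst).
  exact: (measurableT_comp (measurable_funPT Z) measurable_fst).
(* The factor [\1_A] does not depend on the last coordinate, over which [Y'] integrates to the
   quantile at [U], that is to [Z]. *)
transitivity (\int[P \x unif01]_tv (\1_A tv.1 * Z tv.1)%:E).
  apply: ae_eq_integral => //.
    exact: (measurable_fubini_F if').
  apply: filterS2 (ae_law mU (dist_transform_law Z) g1) (qtl_dist_transform iZ).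
  move=> tv gU qU _.
  rewrite /fubini_F /f /Y' /U2/=.
  under eq_integral do rewrite EFinM.
  rewrite indicE; case: (tv.1 \in A) => /=.
    by under eq_integral do rewrite mul1e; rewrite gU qU mul1r.
  by under eq_integral do rewrite mul0e; rewrite integral0 mul0r.
rewrite [RHS]integral_mkcond.
have := @integral_law _ _ _ _ _ (P \x unif01) P fst measurable_fst
  (product_measure_fst P unif01) (fun t => (\1_A t * Z t)%:E) _.
move=> ->.
  apply: eq_integral => t _; rewrite patchE indicE.
  by case: (t \in A); rewrite ?mul1r ?mul0r.
by apply/measurable_EFinP; apply: measurable_funM.
Qed.

End martingale_coupling.

(** * Tail integrals of quantile functions *)

Section tails.
Context d {T : measurableType d} {R : realType} (P : probability T R).
Variable Z : {RV P >-> R}.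
Local Open Scope ereal_scope.

Definition rv_qtl : R -> R := qtl (distribution P Z).

Lemma measurable_rv_qtl : measurable_fun [set: R] rv_qtl.
Proof. exact: measurable_qtl. Qed.

Lemma rv_qtl_law A : measurable A -> unif01 (rv_qtl @^-1` A) = distribution P Z A.
Proof. exact: qtl_law. Qed.

Lemma rv_qtl_le (t r : R) : (0 < t < 1)%R -> (rv_qtl t <= r)%R <-> t%:E <= cdf Z r.
Proof. exact: qtl_le. Qed.

Lemma rv_qtl_nd (s t : R) : (0 < s)%R -> (s <= t)%R -> (t < 1)%R ->
  (rv_qtl s <= rv_qtl t)%R.
Proof. exact: qtl_nd. Qed.

Lemma integral_rv_qtl (f : R -> \bar R) : measurable_fun [set: R] f ->
  \int[unif01]_u f (rv_qtl u) = \int[P]_w f (Z w).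
Proof.
move=> mf; rewrite (integral_law measurable_rv_qtl rv_qtl_law mf).
by rewrite (integral_law (m := P) (n := distribution P Z) (f := Z) _ _ mf).
Qed.

Hypothesis iZ : P.-integrable [set: T] (EFin \o Z).

Lemma integrable_rv_qtl : unif01.-integrable [set: R] (EFin \o rv_qtl).
Proof.
apply: (integrable_law measurable_rv_qtl rv_qtl_law).
exact: integrable_distribution.
Qed.

(** Passes between the Lebesgue integrals of [Rratio] and the uniform law on a half-line, which
    differs from []a, 1[] by a null set. *)
Lemma tail_rv_qtl (a : R) : (0 < a < 1)%R ->
  (\int[lebesgue_measure]_(t in `]a, 1%R[) quantile (cdf Z) t)%:E =
  \int[unif01]_(u in `]a, +oo[) (rv_qtl u)%:E.
Proof.
move=> /andP[a0 a1].
have a01 : `]a, 1%R[%classic `<=` `[0%R, 1%R]%classic.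
  by move=> u /=; rewrite !in_itv/= => /andP[au u1]; rewrite !ltW// (lt_trans a0).
have mq : measurable_fun [set: R] (fun u => (rv_qtl u)%:E).
  by apply/measurable_EFinP; exact: measurable_rv_qtl.
have E : \int[unif01]_(u in `]a, +oo[) (rv_qtl u)%:E =
         \int[lebesgue_measure]_(t in `]a, 1%R[) (quantile (cdf Z) t)%:E.
  rewrite (@eq_integral_unif01 _ _ `]a, 1%R[%classic)//; last first.
    by move=> u /andP[u0 u1]; rewrite /= !in_itv/= u1 !andbT.
  rewrite integral_unif01//; last exact: measurable_funTS.
  apply: eq_integral => u; rewrite inE/= in_itv/= => /andP[au u1].
  by rewrite /rv_qtl /qtl (lt_trans a0 au) u1.
rewrite /Rintegral -E fineK//; apply: integrable_fin_num => //.
exact: integrableS integrable_rv_qtl.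
Qed.

Hypothesis Z0 : \int[P]_w (Z w)%:E = 0.

(** Both [rv_qtl] and the centered indicator have zero integral, so the two constants can be
    inserted freely; they are chosen to give the integrand a sign. *)
Let centered_weight a : (0 < a < 1)%R ->
  \int[unif01]_(u in `]a, +oo[) (rv_qtl u)%:E =
  \int[unif01]_u ((rv_qtl u - rv_qtl a) * (\1_`]a, +oo[ u - (1 - a)))%:E.
Proof.
move=> /andP[a0 a1]; set c := rv_qtl a.
pose A : set R := `]a, +oo[%classic.
have mA : measurable A by exact: measurable_itv.
have ix := integrable_rv_qtl.
have mq : measurable_fun [set: R] (fun u => (rv_qtl u)%:E) := measurable_int _ ix.
have x0 : \int[unif01]_u (rv_qtl u)%:E = 0.
  by rewrite (integral_rv_qtl (f := EFin)).
have i1A : unif01.-integrable [set: R] (fun u => (\1_A u)%:E) by exact: integrable_indic.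
have ic : unif01.-integrable [set: R] (fun=> (1 - a)%:E).
  exact: finite_measure_integrable_cst.
have LA : \int[unif01]_u (\1_A u)%:E = (1 - a)%:E.
  rewrite integral_indic// setIT.
  rewrite (_ : A = ~` `]-oo, a]%classic); last by rewrite setCitvl.
  rewrite [LHS](probability_setC unif01)//.
  by rewrite [X in 1 - X]unif01_itvNyc ?(ltW a0) ?(ltW a1).
have xA : (fun u => (rv_qtl u * \1_A u)%:E) = (EFin \o rv_qtl) \_ A.
  apply/funext => u; rewrite patchE indicE /=.
  by case: (u \in A); rewrite ?mulr1 ?mulr0.
have i1 : unif01.-integrable [set: R] (fun u => (rv_qtl u * \1_A u)%:E).
  rewrite xA; apply: (integrable_mkcond _ mA).1.
  exact: (integrableS measurableT mA _ ix).
have i2 : unif01.-integrable [set: R] (fun u => ((1 - a) * rv_qtl u)%:E).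
  exact: (integrableZl measurableT (1 - a) ix).
have i3 : unif01.-integrable [set: R] (fun u => (c * (\1_A u - (1 - a)))%:E).
  have i4 : unif01.-integrable [set: R] (fun u => (\1_A u)%:E - (1 - a)%:E).
    exact: (integrableB measurableT i1A ic).
  by apply: eq_integrable (integrableZl measurableT c i4).
transitivity (\int[unif01]_u ((rv_qtl u * \1_A u)%:E - ((1 - a) * rv_qtl u)%:E -
                              (c * (\1_A u - (1 - a)))%:E)); last first.
  by apply: eq_integral => u _; rewrite -!EFinB; congr EFin; ring.
rewrite integralB//; last exact: (integrableB measurableT i1 i2).
rewrite integralB// xA -integral_mkcond.
have -> : \int[unif01]_u ((1 - a) * rv_qtl u)%:E = 0.
  by under eq_integral do rewrite EFinM; rewrite integralZl// x0 mule0.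
have -> : \int[unif01]_u (c * (\1_A u - (1 - a)))%:E = 0.
  under eq_integral do rewrite EFinM EFinB.
  rewrite integralZl//; last first.
    exact: (integrableB measurableT i1A ic).
  rewrite integralB//.
  by rewrite LA integral_cst_probability -EFinB subrr mule0.
by rewrite !sube0.
Qed.

(** Both factors change sign at [a], in the same direction. *)
Let weight_ge0 (a u : R) : (0 < a < 1)%R -> (0 < u < 1)%R ->
  (0 <= (rv_qtl u - rv_qtl a) * (\1_`]a, +oo[ u - (1 - a)))%R.
Proof.
move=> /andP[a0 a1] /andP[u0 u1]; rewrite indicE.
case: (leP u a) => ua.
  rewrite (_ : u \in _ = false)/=; last first.
    by apply: memNset; rewrite /= in_itv/= andbT ltNge ua.
  rewrite sub0r mulrN -mulNr opprB mulr_ge0 ?subr_ge0 ?(ltW a1)//.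
  exact: rv_qtl_nd.
rewrite (_ : u \in _ = true)/=; last by apply: mem_set; rewrite /= in_itv/= ua.
by rewrite subKr mulr_ge0 ?(ltW a0)// subr_ge0 rv_qtl_nd// ltW.
Qed.

Let mweight a : measurable_fun [set: R]
  (fun u => (rv_qtl u - rv_qtl a) * (\1_`]a, +oo[ u - (1 - a)))%R.
Proof.
apply: measurable_funM; apply: measurable_funB => //; exact: measurable_rv_qtl.
Qed.

(** Otherwise the nonnegative weighted integrand vanishes almost everywhere. Its second factor is
    [a] or [a - 1], never 0, so the quantile function is constant; the constant is the mean 0,
    against the positive second moment. *)
Lemma tail_gt0 (a : R) : (0 < a < 1)%R -> 0 < \int[P]_w (Z w ^+ 2)%:E ->
  0 < \int[unif01]_(u in `]a, +oo[) (rv_qtl u)%:E.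
Proof.
move=> a01 Z2; rewrite centered_weight//.
set J := \int[_]_u _.
have J0 : 0 <= J.
  rewrite /J (ae_eq_integral (fun u =>
    `|((rv_qtl u - rv_qtl a) * (\1_`]a, +oo[ u - (1 - a)))%:E|))//.
  - exact: integral_ge0.
  - exact/measurable_EFinP.
  - by apply: measurableT_comp => //; exact/measurable_EFinP.
  - by apply: filterS ae_unif01 => u u01 _; rewrite gee0_abs// lee_fin weight_ge0.
rewrite lt_neqAle J0 andbT; apply/eqP => J0'.
have wae : ae_eq unif01 setT (fun u =>
    ((rv_qtl u - rv_qtl a) * (\1_`]a, +oo[ u - (1 - a)))%:E) (cst 0).
  apply/ae_eq_integral_abs => //; first exact/measurable_EFinP.
  rewrite [RHS]J0' /J; apply: ae_eq_integral => //.
  - by apply: measurableT_comp => //; exact/measurable_EFinP.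
  - exact/measurable_EFinP.
  - by apply: filterS ae_unif01 => u u01 _; rewrite gee0_abs// lee_fin weight_ge0.
have cae : {ae unif01, forall u, rv_qtl u = rv_qtl a}.
  apply: filterS wae => u /(_ I) [] /eqP; rewrite mulf_eq0 => /orP[|].
    by rewrite subr_eq0 => /eqP.
  have /andP[a0 a1] := a01.
  rewrite indicE; case: (_ \in _) => /=.
    by rewrite subKr gt_eqF.
  by rewrite sub0r oppr_eq0 subr_eq0 gt_eqF.
have cE (f : R -> R) : measurable_fun [set: R] f -> \int[P]_w (f (Z w))%:E = (f (rv_qtl a))%:E.
  move=> mf; have mf' : measurable_fun [set: R] (fun r => (f r)%:E) by exact/measurable_EFinP.
  rewrite -(integral_rv_qtl mf').
  rewrite (ae_eq_integral (fun=> (f (rv_qtl a))%:E))//.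
  - exact: integral_cst_probability.
  - exact: (measurableT_comp mf' measurable_rv_qtl).
  - by apply: filterS cae => u -> _.
have c0 : rv_qtl a = 0%R by move: Z0; rewrite (cE id)// => -[].
by move: Z2; rewrite (cE (fun r => r ^+ 2)%R)// c0 expr0n/= ltxx.
Qed.

End tails.

Section tails_comparison.
Context d1 d2 {T1 : measurableType d1} {T2 : measurableType d2} {R : realType}.
Variables (P1 : probability T1 R) (P2 : probability T2 R).
Variables (Z : {RV P1 >-> R}) (W : {RV P2 >-> R}).
Local Open Scope ereal_scope.
Hypothesis iZ : P1.-integrable [set: T1] (EFin \o Z).
Hypothesis iW : P2.-integrable [set: T2] (EFin \o W).

(** For every [c], the integral of a quantile function minus [c] over levels above [a] is at most
    the integral of its positive part. For [W] and [c] its quantile at [a] this is an equality,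
    because the difference changes sign at [a]. *)
Lemma tail_le_call :
  (forall c, \int[P1]_w (Num.max (Z w - c) 0)%:E <=
             \int[P2]_w (Num.max (W w - c) 0)%:E) ->
  forall a, (0 < a < 1)%R ->
    \int[unif01]_(u in `]a, +oo[) (rv_qtl Z u)%:E <=
    \int[unif01]_(u in `]a, +oo[) (rv_qtl W u)%:E.
Proof.
move=> ZW a a01; have /andP[a0 a1] := a01; pose c := rv_qtl W a.
have mx := measurable_rv_qtl Z.
have my := measurable_rv_qtl W.
have ix := integrable_rv_qtl iZ.
have iy := integrable_rv_qtl iW.
have mm (f : R -> R) : measurable_fun [set: R] f ->
    measurable_fun [set: R] (fun u => (Num.max (f u - c) 0)%:E).
  move=> mf; apply/measurable_EFinP; apply: measurable_maxr => //.
  exact: measurable_funB.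
have icst : unif01.-integrable [set: R] (fun=> c%:E).
  exact: finite_measure_integrable_cst.
have callE d (T : measurableType d) (P : probability T R) (V : {RV P >-> R}) :
    \int[P]_w (Num.max (V w - c) 0)%:E = \int[unif01]_u (Num.max (rv_qtl V u - c) 0)%:E.
  by rewrite -(integral_rv_qtl V (f := fun r => (Num.max (r - c) 0)%:E))//; exact: (mm id).
have := ZW c; rewrite !callE => {}ZW.
have ma : measurable (`]a, +oo[%classic : set R) by exact: measurable_itv.
have jB (f : R -> R) : unif01.-integrable [set: R] (EFin \o f) ->
    unif01.-integrable `]a, +oo[%classic (fun u => (f u - c)%:E).
  move=> jf; apply: (integrableS measurableT) => //.
  exact: (integrableB measurableT jf icst).
have shift (f : R -> R) : unif01.-integrable [set: R] (EFin \o f) ->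
    \int[unif01]_(u in `]a, +oo[) (f u)%:E =
    \int[unif01]_(u in `]a, +oo[) (f u - c)%:E + c%:E * unif01 `]a, +oo[%classic.
  move=> jf; rewrite -(integral_cst _ ma) -integralD_EFin//.
  - by apply: eq_integral => u _; rewrite /= -EFinD subrK.
  - exact: jB.
  - exact: (integrableS measurableT ma _ icst).
rewrite (shift _ ix) (shift _ iy) leeD2r//.
apply: (@le_trans _ _ (\int[unif01]_u (Num.max (rv_qtl Z u - c) 0)%:E)).
  apply: (@le_trans _ _ (\int[unif01]_(u in `]a, +oo[) (Num.max (rv_qtl Z u - c) 0)%:E)).
    apply: le_integral => //.
    - exact: jB.
    - apply: le_integrable (jB _ ix) => //.
        exact: measurable_funTS (mm _ mx).
      by move=> u _; rewrite /= lee_fin ger0_norm ?le_max ?lexx ?orbT// ge_max ler_norm normr_ge0.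
    - by move=> u _; rewrite lee_fin le_max lexx.
  apply: ge0_subset_integral => //; first exact: mm.
  by move=> u _; rewrite lee_fin le_max lexx orbT.
apply: (le_trans ZW).
rewrite [leRHS]integral_mkcond le_eqVlt; apply/orP; left; apply/eqP.
apply: ae_eq_integral => //.
- exact: mm.
- apply: (measurable_restrictT _ ma).1; exact: measurable_int (jB _ iy).
apply: filterS ae_unif01 => u /andP[u0 u1] _; rewrite patchE.
case: ifPn; [rewrite inE|rewrite notin_setE]; rewrite /= in_itv/= andbT => au.
  by rewrite max_l// subr_ge0; apply: rv_qtl_nd => //; exact: ltW.
have ua : (u <= a)%R by rewrite leNgt; exact/negP.
by rewrite max_r// subr_le0; exact: rv_qtl_nd.
Qed.

(** The second moment clause of the kernel, integrated over the uniform level by Fubini-Tonelli. *)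
Lemma second_moment_le_tail :
  \int[P1]_w (Z w)%:E = \int[P2]_w (W w)%:E ->
  (forall a, (0 < a < 1)%R ->
    \int[unif01]_(u in `]a, +oo[) (rv_qtl Z u)%:E <=
    \int[unif01]_(u in `]a, +oo[) (rv_qtl W u)%:E) ->
  \int[P1]_w (Z w ^+ 2)%:E <= \int[P2]_w (W w ^+ 2)%:E.
Proof.
move=> mean tails.
have int_law d (T : measurableType d) (P : probability T R) (V : {RV P >-> R})
    (f : R -> \bar R) : measurable_fun [set: R] f ->
    \int[P]_w f (V w) = \int[distribution P V]_r f r.
  by move=> mf; rewrite (integral_law (m := P) (n := distribution P V) (f := V) _ _ mf).
have mean' : \int[distribution P1 Z]_r r%:E = \int[distribution P2 W]_r r%:E.
  by rewrite -(int_law _ _ _ Z EFin)// -(int_law _ _ _ W EFin).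
have [g [mg _ g2 gl]] := strassen_unif01
  (integrable_distribution iZ) (integrable_distribution iW) mean' tails.
pose sq (r : R) : \bar R := (r ^+ 2)%:E.
have msq : measurable_fun [set: R] sq by apply/measurable_EFinP; exact: measurable_funX.
have sq0 r : 0 <= sq r by rewrite lee_fin sqr_ge0.
rewrite (int_law _ _ _ W sq)// -(ge0_integral_law mg gl)// -(integral_rv_qtl Z (f := sq))//.
have mg2 : measurable_fun [set: R * R] (fun uw => sq (g uw)) by exact: (measurableT_comp msq mg).
rewrite fubini_tonelli1//.
apply: ae_ge0_le_integral => //.
- exact: (measurableT_comp msq (measurable_rv_qtl Z)).
- by move=> u _; exact: integral_ge0.
- exact: (measurable_fun_fubini_tonelli_F _ mg2 (fun uw => sq0 (g uw))).
- by apply: filterS g2 => u h _; exact: h.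
Qed.


End tails_comparison.

(** Quantile functions are positively homogeneous, since by [rv_qtl_le] they are determined by the
    cdf. [W] is tied to [Z] pointwise so that it can be the projection on [l *: q]. *)
Lemma tail_scale d (T : measurableType d) (R : realType) (P : probability T R)
    (Z W : {RV P >-> R}) (l : R) : 0 <= l -> (forall w, W w = l * Z w) ->
  P.-integrable [set: T] (EFin \o Z) -> forall a,
  (\int[unif01]_(u in `]a, +oo[) (rv_qtl W u)%:E =
   l%:E * \int[unif01]_(u in `]a, +oo[) (rv_qtl Z u)%:E)%E.
Proof.
move=> l0 WZ iZ a.
have qE t : 0 < t < 1 -> rv_qtl W t = l * rv_qtl Z t.
  move=> t01; have /andP[t0 t1] := t01.
  (* For [l = 0] thresholds cannot be divided by [l]; the cdf of [W] jumps from 0 to 1 at 0, so all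
     its quantiles are 0. *)
  have [l00|l_neq0] := eqVneq l 0.
    rewrite l00 mul0r; apply/le_anti/andP; split.
      apply/rv_qtl_le => //; rewrite /cdf (_ : distribution P W _ = 1%E).
        by rewrite lee_fin ltW.
      rewrite -(probability_setT P); congr (P _); apply/seteqP; split => w //= _.
      by rewrite in_itv/= WZ l00 mul0r.
    rewrite leNgt; apply/negP => q0.
    have /(rv_qtl_le W _ t01) := lexx (rv_qtl W t).
    rewrite /cdf (_ : distribution P W _ = 0%E); first by rewrite leNgt lte_fin t0.
    rewrite -(measure0 P); congr (P _); apply/seteqP; split => w //=.
    by rewrite in_itv/= WZ l00 mul0r leNgt q0.
  have {}l0 : 0 < l by rewrite lt_neqAle eq_sym l_neq0.
  have E r : rv_qtl W t <= r <-> l * rv_qtl Z t <= r.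
    rewrite -ler_pdivlMl// mulrC; split => /rv_qtl_le h; apply/rv_qtl_le => //; move: (h t01).
    - rewrite /cdf (_ : distribution P W _ = distribution P Z `]-oo, (r / l)])//.
      congr (P _); apply/seteqP; split => w /=; rewrite !in_itv/= WZ;
      by rewrite ler_pdivlMr// mulrC.
    - rewrite /cdf (_ : distribution P W _ = distribution P Z `]-oo, (r / l)])//.
      congr (P _); apply/seteqP; split => w /=; rewrite !in_itv/= WZ;
      by rewrite ler_pdivlMr// mulrC.
  by apply/le_anti/andP; split; [apply/E|apply/E].
have ix := integrable_rv_qtl iZ.
have ma : measurable (`]a, +oo[%classic : set R) by exact: measurable_itv.
have mq (V : {RV P >-> R}) : measurable_fun [set: R] (fun u => (rv_qtl V u)%:E).
  by apply/measurable_EFinP; exact: measurable_rv_qtl.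
rewrite -integralZl//; last exact: (integrableS measurableT ma _ ix).
apply: ae_eq_integral => //.
- exact: measurable_funTS.
- by apply: measurable_funTS; apply: emeasurable_funM.
by apply: filterS ae_unif01 => u u01 _; rewrite qE// EFinM.
Qed.

(** * The identified set *)

Section centered_projection.
Context {R : realType} {p : nat}.

(** A function of the point of the space and not of [w]: with the mean fixed, equalities in law of
    random vectors apply to it. *)
Definition cdotp (m : 'I_p -> R) (b : 'cV[R]_p) (x : p.-tuple R) : R :=
  \sum_i (tnth x i - m i) * b i ord0.

Lemma measurable_cdotp m b : measurable_fun [set: p.-tuple R] (cdotp m b).
Proof.
apply: measurable_sum => i; apply: measurable_funM => //.
by apply: measurable_funB => //; exact: measurable_tnth.
Qed.

Context d {T : measurableType d} (P : probability T R).

Definition mean (X : T -> p.-tuple R) (i : 'I_p) : R :=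
  fine 'E_P[fun w => tnth (X w) i].

Lemma dotp_vcenter (X : T -> p.-tuple R) b w :
  dotp (vcenter P X w) b = cdotp (mean X) b (X w).
Proof.
rewrite /dotp mxE; apply: eq_bigr => i _.
by rewrite !mxE tnth_mktuple.
Qed.

Variable X : {RV P >-> p.-tuple R}.
Local Open Scope ereal_scope.
Hypothesis iX : forall i, P.-integrable [set: T] (fun w => (tnth (X w) i)%:E).

Lemma integrable_coord i : P.-integrable [set: T] (fun w => (tnth (X w) i - mean X i)%:E).
Proof.
have ic : P.-integrable [set: T] (fun=> (mean X i)%:E).
  exact: finite_measure_integrable_cst.
exact: (integrableB measurableT (iX i) ic).
Qed.

Lemma integral_coord i : \int[P]_w (tnth (X w) i - mean X i)%:E = 0.
Proof.
have ic : P.-integrable [set: T] (fun=> (mean X i)%:E).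
  exact: finite_measure_integrable_cst.
under eq_integral do rewrite EFinB.
rewrite (integralB measurableT (iX i) ic).
rewrite integral_cst_probability /mean unlock fineK ?subee//; exact: integrable_fin_num.
Qed.

Lemma center_dotRVE b w : center_dotRV X b w = cdotp (mean X) b (X w).
Proof. exact: dotp_vcenter. Qed.

Lemma integrable_center_dotRV b : P.-integrable [set: T] (EFin \o center_dotRV X b).
Proof.
rewrite (_ : _ \o _ = fun w => \sum_(i < p) ((b i ord0)%:E * (tnth (X w) i - mean X i)%:E)).
  apply: integrable_sum => // i _; apply: integrableZl => //.
  exact: integrable_coord.
apply/funext => w; rewrite [LHS](congr1 EFin (center_dotRVE b w)) /cdotp -sumEFin.
by apply: eq_bigr => i _; rewrite EFinM muleC.
Qed.

Lemma integral_center_dotRV b : \int[P]_w (center_dotRV X b w)%:E = 0.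
Proof.
transitivity (\int[P]_w (\sum_(i < p) ((b i ord0)%:E * (tnth (X w) i - mean X i)%:E))).
  apply: eq_integral => w _; rewrite center_dotRVE /cdotp -sumEFin.
  by apply: eq_bigr => i _; rewrite EFinM muleC.
rewrite integral_sum//; last first.
  by move=> i; apply: integrableZl => //; exact: integrable_coord.
rewrite big1// => i _; rewrite integralZl//; last exact: integrable_coord.
by rewrite integral_coord mule0.
Qed.

End centered_projection.

Section centered_variable.
Context d {T : measurableType d} {R : realType} (P : probability T R).
Variable Y : {RV P >-> R}.
Local Open Scope ereal_scope.
Hypothesis iY : P.-integrable [set: T] (EFin \o Y).

Lemma integrable_centerRV : P.-integrable [set: T] (EFin \o centerRV Y).
Proof.
have ic : P.-integrable [set: T] (fun=> (fine 'E_P[Y])%:E).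
  exact: finite_measure_integrable_cst.
exact: (integrableB measurableT iY ic).
Qed.

Lemma integral_centerRV : \int[P]_w (centerRV Y w)%:E = 0.
Proof.
have ic : P.-integrable [set: T] (fun=> (fine 'E_P[Y])%:E).
  exact: finite_measure_integrable_cst.
rewrite (eq_integral (fun w => (Y w)%:E - (fine 'E_P[Y])%:E))//.
rewrite (integralB measurableT iY ic).
rewrite integral_cst_probability unlock fineK ?subee//; exact: integrable_fin_num.
Qed.

End centered_variable.

Section equal_laws.
Context d1 d2 d' {T1 : measurableType d1} {T2 : measurableType d2}
  {T' : measurableType d'} {R : realType}.
Variables (P1 : probability T1 R) (P2 : probability T2 R).
Variables (A1 : {RV P1 >-> T'}) (A2 : {RV P2 >-> T'}).
Hypothesis A12 : eq_dist A1 A2.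
Local Open Scope ereal_scope.

Lemma eq_dist_integral (f : T' -> \bar R) : measurable_fun [set: T'] f ->
  \int[P1]_w f (A1 w) = \int[P2]_w f (A2 w).
Proof.
move=> mf.
rewrite (integral_law (m := P1) (n := distribution P1 A1) (f := A1) _ _ mf)//.
rewrite (integral_law (m := P2) (n := distribution P2 A2) (f := A2) _ _ mf)//.
by apply: eq_measure_integral => B mB _; exact: A12.
Qed.

Lemma eq_dist_expectation (f : T' -> R) : measurable_fun [set: T'] f ->
  'E_P1[fun w => f (A1 w)] = 'E_P2[fun w => f (A2 w)].
Proof.
by move=> mf; rewrite !unlock; apply: (eq_dist_integral (f := EFin \o f)); exact/measurable_EFinP.
Qed.

End equal_laws.

Lemma eq_dist_mean (R : realType) (p : nat) d1 d2 (T1 : measurableType d1)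
    (T2 : measurableType d2) (P1 : probability T1 R) (P2 : probability T2 R)
    (X1 : {RV P1 >-> p.-tuple R}) (X2 : {RV P2 >-> p.-tuple R}) :
  eq_dist X1 X2 -> mean P1 X1 = mean P2 X2.
Proof.
move=> X12; apply/funext => i; congr fine.
by apply: (eq_dist_expectation X12 (f := fun x => tnth x i)); exact: measurable_tnth.
Qed.

(** * Membership in the identified set: call functions and couplings *)

Section necessity.
Context d {T : measurableType d} {R : realType} (P : probability T R) (p : nat).
Variables (Y : {RV P >-> R}) (X : {RV P >-> p.-tuple R}) (b : 'cV[R]_p).
Local Open Scope ereal_scope.
Hypothesis iX : forall i, P.-integrable [set: T] (fun w => (tnth (X w) i)%:E).

(** Each side depends on one marginal law, so both can be computed on the coupling space. There the
    event [E] belongs to the sigma-algebra of the centered vector, so [Z'] can be exchanged with the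
    centered outcome on it. *)
Lemma identified_call : identified_set Y X b -> forall c : R,
  \int[P]_w (Num.max (center_dotRV X b w - c) 0)%:E <=
  \int[P]_w (Num.max (centerRV Y w - c) 0)%:E.
Proof.
move=> [d' [T' [P' [X' [Y' [[iY' mZ' iZ' condE] X'X Y'Y]]]]]] c.
have mmax (f : R -> R) : measurable_fun [set: R] f ->
    measurable_fun [set: R] (fun r => (Num.max (f r) 0)%:E).
  by move=> mf; apply/measurable_EFinP; exact: measurable_maxr.
have EYY : fine 'E_P'[Y'] = fine 'E_P[Y].
  by congr fine; exact: (eq_dist_expectation Y'Y (f := id)).
have -> : \int[P]_w (Num.max (centerRV Y w - c) 0)%:E =
          \int[P']_w (Num.max (Defs.center P' Y' w - c) 0)%:E.
  rewrite /Defs.center EYY.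
  apply/esym/(eq_dist_integral Y'Y (f := fun r => (Num.max (r - fine 'E_P[Y] - c) 0)%:E)).
  by apply: mmax; apply: measurable_funB => //; exact: measurable_funB.
have -> : \int[P]_w (Num.max (center_dotRV X b w - c) 0)%:E =
          \int[P']_w (Num.max (dotp (vcenter P' X' w) b - c) 0)%:E.
  under eq_integral do rewrite center_dotRVE.
  under [RHS]eq_integral do rewrite dotp_vcenter (eq_dist_mean X'X).
  apply/esym/(eq_dist_integral X'X (f := fun x => (Num.max (cdotp (mean P X) b x - c) 0)%:E)).
  apply/measurable_EFinP; apply: measurable_maxr => //.
  by apply: measurable_funB => //; exact: measurable_cdotp.
pose Z' w := dotp (vcenter P' X' w) b.
pose E := [set w | (c < Z' w)%R].
have sE : g_sigma_algebra_preimage (vcenter P' X') E.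
  have := mZ' measurableT _ (measurable_itv `]c, +oo[).
  rewrite setTI; congr (g_sigma_algebra_preimage _ _).
  by apply/seteqP; split => w /=; rewrite in_itv/= andbT.
have mZ : measurable_fun [set: T'] Z'.
  by have := measurable_int _ iZ'; move/measurable_EFinP.
have mE : measurable E.
  rewrite -[X in measurable X]setTI.
  by apply: measurable_fun_ltr.
have mY : measurable_fun [set: T'] (Defs.center P' Y').
  by have := measurable_int _ iY'; move/measurable_EFinP.
have ic : P'.-integrable E (fun=> c%:E).
  by apply: (integrableS measurableT) => //; exact: finite_measure_integrable_cst.
have iZE : P'.-integrable E (fun w => (Z' w)%:E) by exact: integrableS iZ'.
have iYE : P'.-integrable E (fun w => (Defs.center P' Y' w)%:E) by exact: integrableS iY'.
have mm (f : T' -> R) : measurable_fun [set: T'] f ->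
    measurable_fun [set: T'] (fun w => (Num.max (f w - c) 0)%:E).
  move=> mf; apply/measurable_EFinP; apply: measurable_maxr => //.
  exact: measurable_funB.
have -> : \int[P']_w (Num.max (Z' w - c) 0)%:E = \int[P']_(w in E) (Defs.center P' Y' w - c)%:E.
  transitivity (\int[P']_(w in E) (Z' w - c)%:E).
    rewrite [RHS]integral_mkcond; apply: eq_integral => w _; rewrite patchE.
    case: ifPn; [rewrite inE|rewrite notin_setE]; rewrite /E/= => cw.
      by rewrite max_l// subr_ge0 ltW.
    by rewrite max_r// subr_le0 leNgt; exact/negP.
  under eq_integral do rewrite EFinB.
  under [RHS]eq_integral do rewrite EFinB.
  by rewrite !integralB// condE.
apply: (@le_trans _ _ (\int[P']_(w in E) (Num.max (Defs.center P' Y' w - c) 0)%:E)).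
  apply: le_integral => //.
  - exact: (integrableB mE iYE ic).
  - apply: le_integrable (integrableB mE iYE ic) => //.
      exact: measurable_funTS (mm _ mY).
    by move=> u _; rewrite /= lee_fin ger0_norm ?le_max ?lexx ?orbT// ge_max ler_norm normr_ge0.
  - by move=> w _; rewrite lee_fin le_max lexx.
apply: ge0_subset_integral => //; first exact: mm.
by move=> w _; rewrite lee_fin le_max lexx orbT.
Qed.

End necessity.

Section sufficiency.
Context d {T : measurableType d} {R : realType} (P : probability T R) (p : nat).
Variables (Y : {RV P >-> R}) (X : {RV P >-> p.-tuple R}) (b : 'cV[R]_p).
Local Open Scope ereal_scope.
Hypothesis iX : forall i, P.-integrable [set: T] (fun w => (tnth (X w) i)%:E).
Hypothesis iY : P.-integrable [set: T] (EFin \o Y).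

(** [X''] is read off the first coordinate of [T * R * R] and has the mean of [X], so the events of
    its centering are preimages under [pr] of events of [T]; on those [martingale_coupling] gives
    the required equality. *)
Lemma tail_le_identified :
  (forall a, (0 < a < 1)%R ->
    \int[unif01]_(u in `]a, +oo[) (rv_qtl (center_dotRV X b) u)%:E <=
    \int[unif01]_(u in `]a, +oo[) (rv_qtl (centerRV Y) u)%:E) ->
  identified_set Y X b.
Proof.
move=> tails.
pose W : {RV P >-> R} := centerRV Y.
have iW := integrable_centerRV iY.
have iZ := integrable_center_dotRV iX b.
have nu_int := integrable_distribution iW.
have mean_eq : \int[P]_w (center_dotRV X b w)%:E = \int[distribution P W]_r r%:E.
  rewrite integral_center_dotRV// integral_distribution//.
  by rewrite (integral_centerRV iY).
have [Y' [mY' lY' cY']] := martingale_coupling iZ nu_int mean_eq tails.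
pose P' : probability (T * R * R)%type R := (P \x unif01) \x unif01.
pose pr : T * R * R -> T := fst \o fst.
have mpr : measurable_fun [set: T * R * R] pr.
  exact: (measurableT_comp measurable_fst measurable_fst).
have lpr A : measurable A -> P' (pr @^-1` A) = P A.
  move=> mA; rewrite -(product_measure_fst P unif01 mA).
  apply: (product_measure_fst (P \x unif01) unif01).
  by rewrite -[X in measurable X]setTI; exact: measurable_fst.
(* The coupling produces the law of the centered outcome; the mean is added back to recover that of
   [Y]. *)
pose m := fine 'E_P[Y].
have mX'' : measurable_fun [set: T * R * R] (X \o pr).
  exact: (measurableT_comp (measurable_funPT X) mpr).
have mY'' : measurable_fun [set: T * R * R] (fun s => Y' s + m)%R.
  exact: measurable_funD.
pose X'' : {RV P' >-> p.-tuple R} :=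
  HB.pack (X \o pr) (isMeasurableFun.Build _ _ _ _ (X \o pr) mX'').
pose Y'' : {RV P' >-> R} :=
  HB.pack (fun s => Y' s + m)%R (isMeasurableFun.Build _ _ _ _ (fun s => Y' s + m)%R mY'').
have X''X : eq_dist X'' X.
  move=> B mB; apply: lpr; exact: measurable_funPTI.
have Y''Y : eq_dist Y'' Y.
  move=> B mB.
  have mB' : measurable ((fun r => r + m)%R @^-1` B).
    rewrite -[X in measurable X]setTI.
    exact: (measurable_funD (@measurable_id _ _ setT) (measurable_cst m)).
  transitivity (distribution P W ((fun r => r + m)%R @^-1` B)).
    exact: (lY' _ mB').
  congr (P _); apply/seteqP; split => w /=.
    by rewrite /W/= /Defs.center subrK.
  by rewrite /W/= /Defs.center subrK.
have cE : Defs.center P' Y'' = Y'.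
  apply/funext => s; rewrite /Defs.center /=.
  rewrite (_ : 'E_P'[_] = 'E_P[Y]); first by rewrite -/m addrK.
  exact: (eq_dist_expectation Y''Y (f := id)).
have vE s : dotp (vcenter P' X'' s) b = center_dotRV X b (pr s).
  by rewrite dotp_vcenter center_dotRVE (eq_dist_mean X''X).
have vcE s : vcenter P' X'' s = vcenter P X (pr s).
  apply: eq_mktuple => i; rewrite /Defs.center; congr (_ - _)%R.
  exact: (congr1 (fun f => f i) (eq_dist_mean X''X)).
have mdot : measurable_fun [set: p.-tuple R] (fun x => dotp x b).
  rewrite [X in measurable_fun _ X](_ : _ = cdotp (fun=> 0%R) b).
    exact: measurable_cdotp.
  apply/funext => x; rewrite /dotp mxE; apply: eq_bigr => i _.
  by rewrite !mxE subr0.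
have mvc : measurable_fun [set: T] (vcenter P X).
  apply/measurable_fun_tnthP => i.
  rewrite [X in measurable_fun _ X](_ : _ = fun w => tnth (X w) i - mean P X i)%R.
    apply: measurable_funB => //.
    exact: (measurableT_comp (measurable_tnth i) (measurable_funPT X)).
  by apply/funext => w; rewrite /= tnth_mktuple.
exists _, (T * R * R)%type, P', X'', Y''; split; [|exact: X''X|exact: Y''Y].
rewrite cE; split.
- exact: (integrable_law mY' lY').
- move=> _ B mB; rewrite setTI; exists ((fun x => dotp x b) @^-1` B).
    by rewrite -[X in measurable X]setTI; exact: mdot.
  by rewrite setTI.
- rewrite (_ : _ \o _ = (EFin \o center_dotRV X b) \o pr).
    exact: (integrable_law mpr lpr).
  by apply/funext => s; exact: (congr1 EFin (vE s)).
- move=> E [C mC <-]; rewrite setTI.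
  pose A := vcenter P X @^-1` C.
  have mA : measurable A by rewrite -[X in measurable X]setTI; exact: mvc.
  have -> : vcenter P' X'' @^-1` C = pr @^-1` A.
    by apply/seteqP; split => s; rewrite /A /preimage/= vcE.
  rewrite [RHS](cY' _ mA).
  rewrite integral_mkcond [RHS]integral_mkcond.
  rewrite -(integral_law mpr lpr (h := (fun w => (center_dotRV X b w)%:E) \_ A)).
    apply: eq_integral => s _; rewrite !patchE vE.
    by have -> : (s \in pr @^-1` A) = (pr s \in A) by apply/idP/idP; rewrite !inE.
  apply: ((measurable_restrictT _ mA).1).
  exact: measurable_funTS (measurable_int _ iZ).
Qed.

End sufficiency.

(** * Square integrability and the covariance form *)

Section square_integrable.
Context d {T : measurableType d} {R : realType} (P : probability T R).
Local Open Scope ereal_scope.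

Lemma integrable_of_sqr (f : T -> R) : measurable_fun [set: T] f ->
  P.-integrable [set: T] (fun w => (f w ^+ 2)%:E) ->
  P.-integrable [set: T] (EFin \o f).
Proof.
move=> mf if2.
have i1 : P.-integrable [set: T] (fun=> 1%:E).
  exact: finite_measure_integrable_cst.
apply: (le_integrable _ _ _ (integrableD measurableT i1 if2)) => //.
  exact/measurable_EFinP.
move=> w _; rewrite /= lee_fin.
rewrite [leRHS]ger0_norm ?addr_ge0 ?sqr_ge0//.
rewrite -[X in (_ + X)%R]real_normK ?num_real//.
have h := sqr_ge0 (`|f w| - 2^-1)%R; nra.
Qed.

Lemma integrable_prod_of_sqr (f g : T -> R) :
  measurable_fun [set: T] f -> measurable_fun [set: T] g ->
  P.-integrable [set: T] (fun w => (f w ^+ 2)%:E) ->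
  P.-integrable [set: T] (fun w => (g w ^+ 2)%:E) ->
  P.-integrable [set: T] (fun w => (f w * g w)%:E).
Proof.
move=> mf mg if2 ig2.
apply: (le_integrable _ _ _ (integrableD measurableT if2 ig2)) => //.
  by apply/measurable_EFinP; exact: measurable_funM.
move=> w _; rewrite /= lee_fin.
rewrite [leRHS]ger0_norm ?addr_ge0 ?sqr_ge0// normrM.
rewrite -[X in (X + _)%R]real_normK ?num_real//.
rewrite -[X in (_ + X)%R]real_normK ?num_real//.
have h1 := normr_ge0 (f w); have h2 := normr_ge0 (g w).
have h3 := sqr_ge0 (`|f w| - `|g w|)%R; nra.
Qed.

Lemma integrable_sqr_shift (f : T -> R) (m : R) : measurable_fun [set: T] f ->
  P.-integrable [set: T] (fun w => (f w ^+ 2)%:E) ->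
  P.-integrable [set: T] (fun w => ((f w - m) ^+ 2)%:E).
Proof.
move=> mf if2.
have i1 : P.-integrable [set: T] (fun=> (2 * m ^+ 2)%:E).
  exact: finite_measure_integrable_cst.
have i2 : P.-integrable [set: T] (fun w => (2 * f w ^+ 2)%:E).
  by apply: eq_integrable (integrableZl measurableT 2%R if2).
apply: (le_integrable _ _ _ (integrableD measurableT i1 i2)) => //.
  by apply/measurable_EFinP; apply: measurable_funX; exact: measurable_funB.
move=> w _; rewrite /= lee_fin.
rewrite [leLHS]ger0_norm ?sqr_ge0// [leRHS]ger0_norm; last first.
  by rewrite addr_ge0// mulr_ge0// sqr_ge0.
(* The dominating function exceeds [(f - m)^2] by exactly this square. *)
have h := sqr_ge0 (f w + m)%R; nra.
Qed.

End square_integrable.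

Section covariance_form.
Context d {T : measurableType d} {R : realType} (P : probability T R) (p : nat).
Variable X : {RV P >-> p.-tuple R}.
Hypothesis iX2 : forall i, P.-integrable [set: T] (fun w => (tnth (X w) i ^+ 2)%:E).

Let V := covmx P X.

Definition qform (u v : 'cV[R]_p) : R := (u^T *m V *m v) ord0 ord0.

Let mX i : measurable_fun [set: T] (fun w => tnth (X w) i).
Proof. exact: (measurableT_comp (measurable_tnth i) (measurable_funPT X)). Qed.

Let C i w := tnth (X w) i - mean P X i.

Let iCC i j : P.-integrable [set: T] (fun w => (C i w * C j w)%:E).
Proof.
apply: integrable_prod_of_sqr; [exact: measurable_funB|exact: measurable_funB| |].
- exact: integrable_sqr_shift.
- exact: integrable_sqr_shift.
Qed.

Let VE i j : (V i j)%:E = (\int[P]_w (C i w * C j w)%:E)%E.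
Proof.
have E : covariance P (fun w => tnth (X w) i) (fun w => tnth (X w) j) =
         (\int[P]_w (C i w * C j w)%:E)%E.
  by rewrite /C /mean covariance.unlock unlock; apply: eq_integral.
by rewrite mxE E fineK//; exact: (integrable_fin_num measurableT (iCC i j)).
Qed.

Lemma qformE u v : (qform u v)%:E =
  (\int[P]_w (center_dotRV X u w * center_dotRV X v w)%:E)%E.
Proof.
transitivity (\int[P]_w (\sum_(i < p) \sum_(j < p)
    ((u i ord0 * v j ord0)%:E * (C i w * C j w)%:E)))%E; last first.
  apply: eq_integral => w _; rewrite !center_dotRVE /cdotp mulr_suml -sumEFin.
  apply: eq_bigr => i _; rewrite mulr_sumr -sumEFin; apply: eq_bigr => j _.
  by rewrite -EFinM /C; congr EFin; ring.
rewrite integral_sum//; last first.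
  by move=> i; apply: integrable_sum => // j _; exact: (integrableZl measurableT _ (iCC i j)).
rewrite /qform mxE -sumEFin.
under eq_bigr do rewrite mxE mulr_suml -sumEFin.
rewrite exchange_big/=; apply: eq_bigr => i _.
rewrite integral_sum//; last by move=> j; exact: (integrableZl measurableT _ (iCC i j)).
apply: eq_bigr => j _; rewrite (integralZl measurableT (iCC i j)).
by rewrite -VE mxE -EFinM; congr EFin; ring.
Qed.

Lemma qform_sqr u : (qform u u)%:E =
  (\int[P]_w (center_dotRV X u w ^+ 2)%:E)%E.
Proof. by rewrite qformE; apply: eq_integral => w _; rewrite expr2. Qed.

Lemma qform_ge0 u : 0 <= qform u u.
Proof.
by rewrite -lee_fin qform_sqr integral_ge0// => w _; rewrite lee_fin sqr_ge0.
Qed.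

Lemma qformC u v : qform u v = qform v u.
Proof.
apply: EFin_inj; rewrite !qformE; apply: eq_integral => w _.
by rewrite mulrC.
Qed.

Lemma qformDZ u v (t : R) :
  qform (u + t *: v) (u + t *: v) = qform u u + 2 * t * qform u v + t ^+ 2 * qform v v.
Proof.
have D (a b c : 'cV[R]_p) (s : R) : qform a (b + s *: c) = qform a b + s * qform a c.
  by rewrite /qform mulmxDr -scalemxAr !mxE.
rewrite D qformC D (qformC (u + _) v) D (qformC v u); ring.
Qed.

Hypothesis V_unit : V \in unitmx.

(** If a nonzero [u] were isotropic, its pairing with [r = V u] would be the squared length of [r],
    positive by invertibility; a small step from [u] against [r] would then make the form
    negative. *)
Lemma qform_gt0 u : u != 0 -> 0 < qform u u.
Proof.
move=> u0; rewrite lt_neqAle qform_ge0 andbT eq_sym; apply/negP => /eqP q0.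
pose r := V *m u.
have Vsym : V^T = V by apply/matrixP => i j; rewrite !mxE covarianceC.
have r0 : r != 0.
  by apply: contraNneq u0 => r0; rewrite -[u](mulKmx V_unit) -/r r0 mulmx0.
have ru : qform u r = \sum_i r i ord0 ^+ 2.
  rewrite /qform -[V]Vsym -trmx_mul -/r mxE.
  by apply: eq_bigr => i _; rewrite mxE expr2.
have ru0 : 0 < qform u r.
  rewrite ru lt_neqAle sumr_ge0 ?andbT; last by move=> i _; exact: sqr_ge0.
  apply: contraNN r0 => /eqP/esym/eqP.
  rewrite psumr_eq0; last by move=> i _; exact: sqr_ge0.
  move=> /allP h; apply/eqP/matrixP => i j; rewrite (ord1 j) [RHS]mxE.
  by have /= := h i (mem_index_enum _); rewrite sqrf_eq0 => /eqP.
set B := qform u r in ru0; set A := qform r r.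
have A0 : 0 <= A by exact: qform_ge0.
(* The step minimising the form is [- B / A]; the denominator [A + 1] also covers [A = 0] and still
   gives a negative value. *)
have := qform_ge0 (u + (- (B / (A + 1))) *: r).
rewrite qformDZ q0 -/A -/B.
rewrite (_ : _ + _ = - (B ^+ 2 / (A + 1) ^+ 2 * (A + 2))); last first.
  by field; lra.
have A1 : 0 < A + 1 by lra.
have A2 : 0 < A + 2 by lra.
by rewrite oppr_ge0 leNgt mulr_gt0// divr_gt0// exprn_gt0.
Qed.

(** The vector [a i] represents the [i]-th coordinate for the covariance form; nonnegativity of the
    form at [u + a i] and [u - a i] bounds that coordinate. *)
Lemma coord_le_qform : exists K : 'I_p -> R, forall (u : 'cV[R]_p) i,
  `|u i ord0| <= K i + qform u u.
Proof.
pose a i : 'cV[R]_p := invmx V *m delta_mx i ord0.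
have Vsym : V^T = V by apply/matrixP => i j; rewrite !mxE covarianceC.
exists (fun i => qform (a i) (a i)) => u i.
have E : qform (a i) u = u i ord0.
  rewrite /qform /a trmx_mul trmx_inv Vsym mulmxKV//.
  by rewrite trmx_delta -rowE mxE.
have h1 := qform_ge0 (u + 1 *: a i).
have h2 := qform_ge0 (u + (-1) *: a i).
have h3 := qform_ge0 (a i); have h4 := qform_ge0 u.
rewrite !qformDZ (qformC u) E in h1 h2.
by rewrite ler_norml; apply/andP; split; lra.
Qed.

End covariance_form.

Section column_compact.
Context {R : realType} {p : nat}.

Lemma trmx_continuous m n : continuous (@trmx R m n).
Proof.
move=> x A /nbhs_ballP[e /= e0 eA].
apply/nbhs_ballP; exists e => //= y [_ h]; apply: eA.
by split => // i j; rewrite !mxE; exact: h.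
Qed.

(** Heine-Borel on row vectors, carried over by transposition; for the sup norm, coordinatewise
    bounds suffice. *)
Lemma bounded_closed_compact_cV (A : set 'cV[R]_p) (K : 'I_p -> R) :
  (forall v i, A v -> `|v i ord0| <= K i) -> closed A -> compact A.
Proof.
move=> AK clA.
have -> : A = (@trmx R 1 p) @` ((@trmx R 1 p) @^-1` A).
  apply/seteqP; split => [v Av|_ [v Av <-]//].
  by exists v^T; rewrite /= ?trmxK.
apply: continuous_compact.
  by apply: continuous_subspaceT; exact: trmx_continuous.
apply: bounded_closed_compact.
  exists (\sum_i `|K i|); split; first exact: num_real.
  move=> M KM v /= Av.
  have M0 : 0 <= M by rewrite (le_trans _ (ltW KM))// sumr_ge0.
  rewrite [leLHS]/Num.norm/= mx_normrE; apply/bigmax_leP; split => // -[i j] _ /=.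
  rewrite (ord1 i); apply: le_trans (ltW KM).
  apply: (@le_trans _ _ `|K j|); last by rewrite (bigD1 j)//= lerDl sumr_ge0.
  by have := AK _ j Av; rewrite mxE => /le_trans; apply; exact: ler_norm.
by apply: closed_comp => // v _; exact: trmx_continuous.
Qed.

End column_compact.

(** * Convexity and compactness of the identified set *)

Section identified.
Context d {T : measurableType d} {R : realType} (P : probability T R) (p : nat).
Variables (Y : {RV P >-> R}) (X : {RV P >-> p.-tuple R}).
Hypothesis iX2 : forall i, P.-integrable [set: T] (fun w => (tnth (X w) i ^+ 2)%:E).
Hypothesis iY2 : P.-integrable [set: T] (fun w => (Y w ^+ 2)%:E).
Local Open Scope ereal_scope.

Let mX i : measurable_fun [set: T] (fun w => tnth (X w) i).
Proof. exact: (measurableT_comp (measurable_tnth i) (measurable_funPT X)). Qed.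

Let iX i : P.-integrable [set: T] (fun w => (tnth (X w) i)%:E).
Proof. exact: (integrable_of_sqr (mX i) (iX2 i)). Qed.

Let iY : P.-integrable [set: T] (EFin \o Y).
Proof. exact: integrable_of_sqr. Qed.

Definition call (Z : T -> R) (c : R) : \bar R := \int[P]_w (Num.max (Z w - c) 0)%:E.

Let mcall (Z : {RV P >-> R}) (c : R) :
  measurable_fun [set: T] (fun w => (Num.max (Z w - c) 0)%:E).
Proof.
by apply/measurable_EFinP; apply: measurable_maxr => //; exact: measurable_funB.
Qed.

Let call0 (Z : T -> R) (c : R) w : 0 <= (Num.max (Z w - c) 0)%:E.
Proof. by rewrite lee_fin le_max lexx orbT. Qed.

Lemma identified_callP b : identified_set Y X b <->
  forall c, call (center_dotRV X b) c <= call (centerRV Y) c.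
Proof.
split; first exact: identified_call.
move=> h; apply: tail_le_identified => //; apply: tail_le_call => //.
- exact: integrable_center_dotRV.
- exact: integrable_centerRV.
Qed.

Lemma identified_tailP b : identified_set Y X b <->
  forall a, (0 < a < 1)%R ->
    \int[unif01]_(u in `]a, +oo[) (rv_qtl (center_dotRV X b) u)%:E <=
    \int[unif01]_(u in `]a, +oo[) (rv_qtl (centerRV Y) u)%:E.
Proof.
split; last exact: tail_le_identified.
move=> /identified_callP h; apply: tail_le_call => //.
- exact: integrable_center_dotRV.
- exact: integrable_centerRV.
Qed.

Lemma variance_centerRV : 'V_P[Y] = \int[P]_w (centerRV Y w ^+ 2)%:E.
Proof.
rewrite /variance covariance.unlock unlock; apply: eq_integral => w _.
by rewrite expr2 /= /Defs.center unlock.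
Qed.

Lemma identified_qform b : identified_set Y X b -> (qform X b b)%:E <= 'V_P[Y].
Proof.
move=> /identified_tailP h; rewrite qform_sqr// variance_centerRV.
apply: second_moment_le_tail => //.
- exact: integrable_center_dotRV.
- exact: integrable_centerRV.
- by rewrite integral_center_dotRV// integral_centerRV.
Qed.

Lemma center_dotRV_lin (u v : 'cV[R]_p) (s t : R) w :
  center_dotRV X (s *: u + t *: v)%R w =
  (s * center_dotRV X u w + t * center_dotRV X v w)%R.
Proof.
rewrite !center_dotRVE /cdotp !mulr_sumr -big_split/=; apply: eq_bigr => i _.
by rewrite !mxE; ring.
Qed.

(** For each [c] the call function is convex in [b], being the mean of the positive part of an
    affine function of [b]; the set is an intersection of sublevel sets. *)
Lemma convex_identified : convex_set (identified_set Y X).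
Proof.
apply/convex_setW => x y; rewrite !inE => /identified_callP hx /identified_callP hy k k0 k1.
rewrite inE; apply/identified_callP => c.
set t := (k%:num)%R in k0 k1.
have -> : conv k x y = (t *: x + (1 - t) *: y)%R by [].
have t0 : (0 <= t)%R by exact: ltW.
have t1 : (0 <= 1 - t)%R by rewrite subr_ge0 ltW.
apply: (@le_trans _ _ (t%:E * call (center_dotRV X x) c +
                       (1 - t)%:E * call (center_dotRV X y) c)).
  rewrite -!ge0_integralZl_EFin//; try exact: mcall.
  rewrite -ge0_integralD//; last 4 first.
  - by move=> w _; rewrite mule_ge0// lee_fin.
  - by apply: emeasurable_funM => //; exact: mcall.
  - by move=> w _; rewrite mule_ge0// lee_fin.
  - by apply: emeasurable_funM => //; exact: mcall.
  apply: ge0_le_integral => //.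
    by apply: emeasurable_funD; apply: emeasurable_funM => //; exact: mcall.
  move=> w _; rewrite -!EFinM -EFinD lee_fin center_dotRV_lin.
  set a := center_dotRV X x w; set b := center_dotRV X y w.
  rewrite ge_max; apply/andP; split; last first.
    by rewrite addr_ge0// mulr_ge0// le_max lexx orbT.
  have h1 : (a - c <= Num.max (a - c) 0)%R by rewrite le_max lexx.
  have h2 : (b - c <= Num.max (b - c) 0)%R by rewrite le_max lexx.
  by nra.
apply: (@le_trans _ _ (t%:E * call (centerRV Y) c + (1 - t)%:E * call (centerRV Y) c)).
  by apply: leeD; apply: lee_wpmul2l; rewrite ?lee_fin.
by rewrite -ge0_muleDl ?lee_fin// -EFinD addrC subrK mul1e.
Qed.

(** For each [c] the call function is Lipschitz in [b] for the sup norm, with constant [K], the sum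
    of the mean absolute deviations of the coordinates. *)
Lemma closed_identified : closed (identified_set Y X).
Proof.
move=> b clb; apply/identified_callP => c; apply/lee_addgt0Pr => e e0.
pose K : R := (\sum_i fine (\int[P]_w `|tnth (X w) i - mean P X i|%:E))%R.
have K0 : (0 <= K)%R.
  by apply: sumr_ge0 => i _; apply: fine_ge0; exact: integral_ge0.
(* Chosen so that [r * K <= e]; adding 1 avoids a division by zero. *)
pose r := (e / (K + 1))%R.
have r0 : (0 < r)%R by rewrite divr_gt0// ltr_pwDr.
have [g [/identified_callP hg [_ gb]]] := clb _ (nbhsx_ballx b r r0).
have ia i : P.-integrable [set: T] (fun w => `|tnth (X w) i - mean P X i|%:E).
  by have := integrable_abse (integrable_coord iX i).
have mabs i : measurable_fun [set: T] (fun w => `|tnth (X w) i - mean P X i|%:E).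
  exact: (measurable_int _ (ia i)).
apply: (@le_trans _ _ (call (center_dotRV X g) c +
    \int[P]_w (\sum_(i < p) (r%:E * `|tnth (X w) i - mean P X i|%:E)))).
  rewrite -ge0_integralD//; last 2 first.
  - by move=> w _; apply: sume_ge0 => i _; rewrite mule_ge0// lee_fin// ltW.
  - by apply: emeasurable_sum => i; apply: emeasurable_funM.
  apply: ge0_le_integral => //.
    apply: emeasurable_funD; first exact: mcall.
    by apply: emeasurable_sum => i; apply: emeasurable_funM.
  move=> w _; rewrite (eq_bigr (fun i => (r * `|tnth (X w) i - mean P X i|)%:E))//.
  rewrite sumEFin -EFinD lee_fin.
  have h : (center_dotRV X b w - center_dotRV X g w <=
            \sum_i r * `|tnth (X w) i - mean P X i|)%R.
    rewrite !center_dotRVE /cdotp -sumrB; apply: ler_sum => i _.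
    rewrite -mulrBr (le_trans (ler_norm _))// normrM mulrC ler_wpM2r//.
    exact: ltW (gb i ord0).
  have h0 : (0 <= \sum_i r * `|tnth (X w) i - mean P X i|)%R.
    by apply: sumr_ge0 => i _; rewrite mulr_ge0// ltW.
  rewrite ge_max; apply/andP; split; last by rewrite addr_ge0// le_max lexx orbT.
  have h1 : (center_dotRV X g w - c <= Num.max (center_dotRV X g w - c) 0)%R.
    by rewrite le_max lexx.
  by lra.
apply: leeD => //.
rewrite integral_sum//; last first.
  by move=> i; exact: (integrableZl measurableT _ (ia i)).
rewrite (eq_bigr (fun i =>
    (r * fine (\int[P]_w `|tnth (X w) i - mean P X i|%:E))%:E)); last first.
  move=> i _; rewrite (integralZl measurableT (ia i)).
  have /fineK {1}<- := integrable_fin_num measurableT (ia i).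
  by rewrite -EFinM.
rewrite sumEFin -mulr_sumr -/K lee_fin /r -mulrAC ler_pdivrMr ?ltr_pwDr//.
by rewrite ler_wpM2l ?lerDl// ltW.
Qed.

Hypothesis V_unit : covmx P X \in unitmx.

(** The variance bound controls the covariance form, which by invertibility controls every
    coordinate. *)
Lemma compact_identified : compact (identified_set Y X).
Proof.
have [K hK] := coord_le_qform iX2 V_unit.
apply: (@bounded_closed_compact_cV _ _ _ (fun i => K i + fine 'V_P[Y])%R).
  move=> b i hb; apply: le_trans (hK b i) _; rewrite lerD2l -lee_fin fineK.
    exact: identified_qform.
  rewrite variance_centerRV; apply: integrable_fin_num => //.
  exact: integrable_sqr_shift.
exact: closed_identified.
Qed.

End identified.

(** * The sharp bound in a fixed direction *)

Section ratio_characterization.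
Context d {T : measurableType d} {R : realType} (P : probability T R) (p : nat).
Variables (Y : {RV P >-> R}) (X : {RV P >-> p.-tuple R}).
Hypothesis iX2 : forall i, P.-integrable [set: T] (fun w => (tnth (X w) i ^+ 2)%:E).
Hypothesis iY2 : P.-integrable [set: T] (fun w => (Y w ^+ 2)%:E).
Hypothesis VY : (0 < 'V_P[Y])%E.
Hypothesis V_unit : covmx P X \in unitmx.

Let iX i : P.-integrable [set: T] (fun w => (tnth (X w) i)%:E).
Proof.
apply: integrable_of_sqr => //.
exact: (measurableT_comp (measurable_tnth i) (measurable_funPT X)).
Qed.

Let iZ q : P.-integrable [set: T] (EFin \o center_dotRV X q).
Proof. exact: integrable_center_dotRV. Qed.

Let iW : P.-integrable [set: T] (EFin \o centerRV Y).
Proof. by apply: integrable_centerRV; exact: integrable_of_sqr. Qed.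

Let tail (Z : {RV P >-> R}) (a : R) : R :=
  \int[lebesgue_measure]_(t in `]a, 1[) quantile (cdf Z) t.

Let tailY_gt0 a : 0 < a < 1 -> 0 < tail (centerRV Y) a.
Proof.
move=> a01; rewrite -lte_fin tail_rv_qtl// tail_gt0//.
  by apply: integral_centerRV; exact: integrable_of_sqr.
by rewrite -variance_centerRV.
Qed.

Let tailX_gt0 q a : q != 0 -> 0 < a < 1 -> 0 < tail (center_dotRV X q) a.
Proof.
move=> q0 a01; rewrite -lte_fin tail_rv_qtl// tail_gt0//.
  exact: integral_center_dotRV.
by rewrite -qform_sqr// lte_fin qform_gt0.
Qed.

Lemma identified_scaleP (l : R) (q : 'cV[R]_p) : 0 <= l ->
  identified_set Y X (l *: q) <->
  forall a, 0 < a < 1 -> l * tail (center_dotRV X q) a <= tail (centerRV Y) a.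
Proof.
move=> l0.
have Zl w : center_dotRV X (l *: q) w = l * center_dotRV X q w.
  have := center_dotRV_lin X q 0 l 0 w.
  by rewrite scale0r addr0 mul0r addr0.
rewrite (identified_tailP iX2 iY2); split => h a a01; have := h a a01;
  rewrite (tail_scale l0 Zl (iZ q)) -!tail_rv_qtl// -EFinM lee_fin;
  exact.
Qed.

Lemma identified0 : identified_set Y X 0.
Proof.
rewrite -(scale0r (0 : 'cV[R]_p)); apply/identified_scaleP => // a a01.
by rewrite mul0r ltW// tailY_gt0.
Qed.

(** The tail of the projection is positive, so the tail inequality for each [a] is a bound on [l] by
    the ratio at [a]. The ratios are nonempty and bounded below by 0, so the real infimum is a
    genuine one. *)
Lemma identified_le_Sratio (l : R) (q : 'cV[R]_p) : 0 <= l -> q != 0 ->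
  identified_set Y X (l *: q) <->
  l <= Sratio (cdf (centerRV Y)) (cdf (center_dotRV X q)).
Proof.
move=> l0 q0; rewrite identified_scaleP// /Sratio.
set E := [set _ | _ in _].
split => [h|h a a01].
  apply: lb_le_inf.
    by exists (Rratio 2^-1 (cdf (centerRV Y)) (cdf (center_dotRV X q))); exists 2^-1 => //=;
      rewrite in_itv/= invr_gt0 ltr0n invf_lt1 ?ltr1n.
  move=> _ [a + <-]; rewrite /= in_itv/= => a01.
  by rewrite /Rratio ler_pdivlMr; [exact: h|exact: tailX_gt0].
rewrite -ler_pdivlMr ?tailX_gt0//; apply: (le_trans h).
apply: ge_inf; last by exists a.
exists 0 => _ [c + <-]; rewrite /= in_itv/= => c01.
by apply: divr_ge0; apply: ltW; [exact: tailY_gt0|exact: tailX_gt0].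
Qed.

End ratio_characterization.

(** * Polar coordinates for the Euclidean norm *)

Section polar.
Context {R : realType} {p : nat}.

Lemma enorm_eq0 (v : 'cV[R]_p) : enorm v = 0 -> v = 0.
Proof.
move=> /eqP; rewrite sqrtr_eq0 => v0; apply/matrixP => i j; rewrite (ord1 j) mxE.
have : \sum_i v i ord0 ^+ 2 == 0.
  by rewrite eq_le v0 sumr_ge0// => k _; exact: sqr_ge0.
rewrite psumr_eq0; last by move=> k _; exact: sqr_ge0.
move=> /allP/(_ i (mem_index_enum _)) /=.
by rewrite sqrf_eq0 => /eqP.
Qed.

Lemma enormZ (l : R) (v : 'cV[R]_p) : 0 <= l -> enorm (l *: v) = l * enorm v.
Proof.
move=> l0; rewrite /enorm -{2}(ger0_norm l0) -sqrtr_sqr -sqrtrM ?sqr_ge0//.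
rewrite mulr_sumr; congr Num.sqrt; apply: eq_bigr => i _.
by rewrite mxE exprMn.
Qed.

Lemma unit_sphere_neq0 (q : 'cV[R]_p) : unit_sphere q -> q != 0.
Proof.
move=> /= q1; apply/eqP => q0; have /eqP := q1.
rewrite q0 /enorm big1 ?sqrtr0 ?(eq_sym 0) ?oner_eq0// => i _.
by rewrite mxE expr0n.
Qed.

Lemma polar_decomposition (v : 'cV[R]_p) : (0 < p)%N ->
  exists (l : R) (q : 'cV[R]_p), [/\ 0 <= l, unit_sphere q & v = l *: q].
Proof.
move=> p0; have [v0|v0] := eqVneq (enorm v) 0.
  (* The zero vector has no direction of its own; a basis vector is supplied, which exists as [p] is
     positive. *)
  exists 0, (delta_mx (Ordinal p0) ord0); split => //.
    rewrite /unit_sphere /= /enorm (bigD1 (Ordinal p0))//= big1 => [|i ip].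
      by rewrite mxE !eqxx addr0 expr1n sqrtr1.
    by rewrite mxE (negbTE ip) expr0n.
  by rewrite scale0r; exact: enorm_eq0.
have n0 : 0 <= enorm v by exact: sqrtr_ge0.
exists (enorm v), ((enorm v)^-1 *: v); split => //.
  by rewrite /unit_sphere /= enormZ ?invr_ge0// mulVf.
by rewrite scalerA divff// scale1r.
Qed.

End polar.

Theorem theorem1 (R : realType) (d : measure_display) (T : measurableType d)
  (P : probability T R) (p : nat) (p_gt0 : (0 < p)%N)
  (Y : {RV P >-> R}) (X : {RV P >-> p.-tuple R})
  (EY2 : ('E_P[(fun w => Y w ^+ 2)%R] < +oo)%E)
  (EX2 : ('E_P[(fun w => enorm (vec (X w)) ^+ 2)%R] < +oo)%E)
  (VY : (0 < 'V_P[Y])%E)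
  (VX : covmx P X \in unitmx)
  (lin : exists (alpha0 : R) (beta0 : 'cV[R]_p),
    is_condE P Y X (fun w => alpha0 + dotp (X w) beta0)) :
  identified_set Y X =
    [set beta | exists (lambda : R) (q : 'cV[R]_p),
      [/\ unit_sphere q,
          0 <= lambda <= Sratio (cdf (centerRV Y)) (cdf (center_dotRV X q)) &
          beta = lambda *: q]] /\
  [/\ identified_set Y X 0,
      convex_set (identified_set Y X),
      compact (identified_set Y X) &
      identified_set Y X `<=` variance_bound_set Y X].
Proof.
have iY2 : P.-integrable [set: T] (fun w => (Y w ^+ 2)%:E).
  apply/integrableP; split; first by apply/measurable_EFinP; exact: measurable_funX.
  apply: le_lt_trans EY2; rewrite unlock.
  by under eq_integral do rewrite gee0_abs ?lee_fin ?sqr_ge0//.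
have enormE w : enorm (vec (X w)) ^+ 2 = \sum_i tnth (X w) i ^+ 2.
  rewrite sqr_sqrtr; last by apply: sumr_ge0 => i _; exact: sqr_ge0.
  by apply: eq_bigr => i _; rewrite mxE.
have mX i : measurable_fun [set: T] (fun w => tnth (X w) i).
  exact: (measurableT_comp (measurable_tnth i) (measurable_funPT X)).
(* The square of each coordinate is dominated by the squared Euclidean norm. *)
have iX2 i : P.-integrable [set: T] (fun w => (tnth (X w) i ^+ 2)%:E).
  apply/integrableP; split; first by apply/measurable_EFinP; exact: measurable_funX.
  apply: le_lt_trans EX2; rewrite unlock; apply: ge0_le_integral => //.
  - apply: measurableT_comp => //.
    by apply/measurable_EFinP; exact: measurable_funX.
  - apply/measurable_EFinP; rewrite (_ : (fun w => _) = fun w => \sum_i tnth (X w) i ^+ 2).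
      by apply: measurable_sum => j; exact: measurable_funX.
    by apply/funext => w; rewrite enormE.
  move=> w _; rewrite gee0_abs ?lee_fin ?sqr_ge0// enormE.
  by rewrite (bigD1 i)//= lerDl sumr_ge0// => j _; exact: sqr_ge0.
split.
  apply/seteqP; split => [b hb|_ [l [q [q1 /andP[l0 lS] ->]]]].
    have [l [q [l0 q1 bE]]] := polar_decomposition b p_gt0.
    exists l, q; split => //; rewrite l0.
    apply/(identified_le_Sratio iX2 iY2 VY VX) => //.
      exact: unit_sphere_neq0.
    by rewrite -bE.
  by apply/(identified_le_Sratio iX2 iY2 VY VX) => //; exact: unit_sphere_neq0.
split.
- exact: identified0.
- exact: convex_identified.
- exact: compact_identified.
- by move=> b hb; exact: identified_qform.
Qed.
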